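(* Let $N>1$ be an integer and let $u,u',v,v'\in\mathbb C$ satisfy $(u+k)(u'+k)>0$ and $(v+k)(v'+k)>0$ for all $k\in\mathbb Z$, and $u+u'+v+v'>-1$. Then the matrix of transition rates $\mathcal D^{(N)}$ on $\mathbb{GT}_N$ is regular. The corresponding Markov semigroup $(P_N(t))_{t\ge0}$ has the form $$P_N(t;\lambda,\nu)=e^{-d_Nt}\,\frac{\mathrm{Dim}_N(\nu)}{\mathrm{Dim}_N(\lambda)}\det\bigl[P_1(t;\lambda_i+N-i,\nu_j+N-j)\bigr]_{i,j=1}^N,\qquad \lambda,\nu\in\mathbb{GT}_N .$$ Moreover, this semigroup is Feller.
   Context: $\mathbb{GT}_N$ is the countable discrete set of signatures $\lambda=(\lambda_1\ge\dots\ge\lambda_N)\in\mathbb Z^N$ and $\mathrm{Dim}_N\lambda=\prod_{1\le i<j\le N}(\lambda_i-i-\lambda_j+j)\big/\prod_{i=1}^{N-1}i!$. Let $\mathcal D$ be the matrix on $\mathbb Z\times\mathbb Z$ with $\mathcal D(x,x+1)=(x-u)(x-u')$, $\mathcal D(x,x-1)=(x+v)(x+v')$, $\mathcal D(x,x)=-(x-u)(x-u')-(x+v)(x+v')$, and all other entries $0$. It is regular (see below); $(P_1(t))_{t\ge0}$ denotes the corresponding Markov semigroup on $\mathbb Z$. With $l_j=\lambda_j+N-j$, $n_j=\nu_j+N-j$, $$\mathcal D^{(N)}(\lambda,\nu)=\frac{\mathrm{Dim}_N(\nu)}{\mathrm{Dim}_N(\lambda)}\sum_{k=1}^N\mathcal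 D(l_k,n_k)\mathbf 1_{\{l_i=n_i\ \forall i\ne k\}}-d_N\mathbf 1_{\lambda=\nu},\qquad d_N=\frac{N(N-1)(N-2)}3-(u+u'+v+v')\frac{N(N-1)}2 .$$ **Regularity.** A matrix of transition rates $Q$ on a countable set $E$ is a real matrix with $Q(a,b)\ge0$ for $a\ne b$ and $\sum_{b\ne a}Q(a,b)=-Q(a,a)$ for all $a$. Its minimal solution $\overline P(t)$ is the smallest nonnegative (substochastic) matrix solution of $\frac d{dt}P(t)=QP(t)$, $t>0$, $P(0)=\mathrm{Id}$; explicitly $\overline P(t)=\sum_{n\ge0}P^{[n]}(t)$ with $P^{[0]}(t)=e^{-tq}$, $P^{[n]}(t)=\int_0^te^{-\tau q}\widetilde QP^{[n-1]}(t-\tau)d\tau$, where $-q$ and $\widetilde Q$ are the diagonal and off-diagonal parts of $Q$. $Q$ is regular if $\overline P(t)$ is stochastic (row sums $1$) for all $t\ge0$; then $P(t)=\overline P(t)$ is the corresponding Markov semigroup. **Feller.** A Markov semigroup on a countable discrete set $E$ is Feller if it maps $C_0(E)$ (functions tending to $0$ at infinity, sup-norm) to itself and $t\mapsto P(t)f$ is norm-continuous on $[0,\infty)$ for every $f\in C_0(E)$. *)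

(* Defs.v *)
From HB Require Import structures.
From mathcomp Require Import all_boot all_order all_algebra.
From mathcomp Require Import complex.
From mathcomp Require Import all_classical all_reals all_analysis.
Import Order.TTheory GRing.Theory Num.Theory.
Import numFieldNormedType.Exports.

Set Implicit Arguments.
Unset Strict Implicit.
Unset Printing Implicit Defensive.

Local Open Scope classical_set_scope.
Local Open Scope ring_scope.

Section MarkovChains.
Variables (R : realType) (E : countType).
Implicit Types (Q : E -> E -> R) (P : R -> E -> E -> R) (f : E -> R).

Definition is_rate_matrix Q : Prop :=
  (forall a b, a != b -> 0 <= Q a b) /\
  (forall a, \esum_(b in [set~ a]) (Q a b)%:E = (- Q a a)%:E)%E.

(* The terms P^[n](t) of the series for the minimal solution of the backward
   equation P' = QP, P(0) = Id: paths with exactly n jumps. Since the diagonal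
   part of Q is -q, the weight e^{-tq(a)} is [expR (t * Q a a)]. *)
Fixpoint minimal_solution_term Q (n : nat) (t : R) (a b : E) : \bar R :=
  match n with
  | 0 => ((expR (t * Q a a)) *+ (a == b))%:E
  | m.+1 => (\int[lebesgue_measure]_(tau in `[0%R, t])
      ((expR (tau * Q a a))%:E *
       \esum_(c in [set~ a])
         ((Q a c)%:E * minimal_solution_term Q m (t - tau)%R c b)))%E
  end.

Definition minimal_solution Q (t : R) (a b : E) : \bar R :=
  (\sum_(0 <= n <oo) minimal_solution_term Q n t a b)%E.

Definition regular Q : Prop :=
  is_rate_matrix Q /\
  forall t, 0 <= t -> forall a,
    (\esum_(b in [set: E]) minimal_solution Q t a b = 1)%E.

(* Only meaningful for t >= 0; the entries of the minimal solution of a rate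
   matrix are finite, so [fine] loses nothing. *)
Definition markov_semigroup Q (t : R) (a b : E) : R :=
  fine (minimal_solution Q t a b).

(* [esum] is meant for nonnegative families, hence the splitting of the
   absolutely convergent series \sum_b P(t; a, b) f(b). *)
Definition semigroup_apply P (t : R) f (a : E) : R :=
  let g := fun b => (P t a b * f b)%:E in
  fine (\esum_(b in [set: E]) (g^\+)%E b - \esum_(b in [set: E]) (g^\-)%E b)%E.

Definition C0 : set (E -> R) :=
  [set f | forall eps : R, 0 < eps -> finite_set [set a | eps <= `|f a|]].

Definition sup_norm f : \bar R := ereal_sup [set `|f a|%:E | a in [set: E]].

Definition feller P : Prop :=
  (forall t, 0 <= t -> forall f, C0 f -> C0 (semigroup_apply P t f)) /\
  (forall f, C0 f -> forall t, 0 <= t ->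
    sup_norm (semigroup_apply P s f \- semigroup_apply P t f)
      @[s --> within `[0, +oo[ (nbhs t)] --> 0%E).

End MarkovChains.

(* Signatures; the N coordinates are numbered from 0, so that the usual
   lambda_i is [tnth lam i'] with i = i' + 1. *)
Definition signature (N : nat) : Type :=
  {lam : N.-tuple int | sorted >=%R (lam : seq int)}.
HB.instance Definition _ (N : nat) := Countable.on (signature N).

(* l_i = lambda_i + N - i for the usual numbering i = 1, ..., N. *)
Definition shifted (N : nat) (lam : signature N) (i : 'I_N) : int :=
  tnth (val lam) i + (N.-1)%:Z - (i : nat)%:Z.

Definition Dim (R : realType) (N : nat) (lam : signature N) : R :=
  (\prod_(i < N) \prod_(j < N | (i < j)%N)
     ((tnth (val lam) i - (i : nat)%:Z - tnth (val lam) j + (j : nat)%:Z)%:~R))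
  / (\prod_(1 <= i < N) (i`!)%:R).

Section Rates.
Variables (R : realType) (u u' v v' : complex R).

(* For the parameters considered below u + u', u u', v + v' and v v' are real,
   so taking real parts only casts real complex numbers to R. *)
Definition rate_up (x : int) : R := complex.Re ((x%:~R - u) * (x%:~R - u')).
Definition rate_down (x : int) : R := complex.Re ((x%:~R + v) * (x%:~R + v')).

Definition calD (x y : int) : R :=
  if y == x + 1 then rate_up x
  else if y == x - 1 then rate_down x
  else if y == x then - rate_up x - rate_down x
  else 0.

Definition dconst (N : nat) : R :=
  N%:R * (N%:R - 1) * (N%:R - 2) / 3
  - complex.Re (u + u' + v + v') * (N%:R * (N%:R - 1) / 2).

Definition calDN (N : nat) (lam nu : signature N) : R :=
  Dim R nu / Dim R lam *
    (\sum_(k < N) calD (shifted lam k) (shifted nu k) *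
       [forall i : 'I_N, (i != k) ==> (shifted lam i == shifted nu i)]%:R)
  - dconst N * (lam == nu)%:R.

End Rates.

(* Main.v *)
Require Import Defs.
From HB Require Import structures.
From mathcomp Require Import all_boot all_order perm all_algebra.
From mathcomp Require Import complex.
From mathcomp Require Import all_classical all_reals all_analysis.
From mathcomp Require Import measurable_realfun ring lra zify.
Import Order.TTheory GRing.Theory Num.Theory.
Import numFieldNormedType.Exports.
Set Implicit Arguments.
Unset Strict Implicit.
Unset Printing Implicit Defensive.
Local Open Scope classical_set_scope.
Local Open Scope ring_scope.

(** The rates on signatures are obtained from N independent copies of the
birth-death chain D on the integers: in the coordinates l_i the matrix
D^(N) + d_N is the sum of the operators D acting on the single coordinates,
conjugated by the dimension, which is a multiple of the Vandermonde
determinant V ([Dim_gen]). Alternating functions vanish wherever a particle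
would step onto another one, so the walls of the chamber may be ignored.
On the powers of x the operator D is triangular with diagonal coefficients
m (m - 1) - (u + u' + v + v') m, hence V is an eigenfunction with eigenvalue d_N
and the rows of D^(N) sum to zero.

The probabilistic content is a comparison principle ([comparison]) for the
backward equation w' = Q w of a chain with finitely many jumps from each state.
It needs a function F >= 1 with Q F <= c F and jump rates at most c F; then
a function that is bounded below, satisfies w' >= Q w and starts nonnegative
stays nonnegative. Bounded solutions are thus unique, and comparing finite sums
of entries of the minimal solution with 1 - e^{ct} F / K shows that no mass is
lost ([regular_lyapunov]). For D one takes F = 1 + x^2, for D^(N) the function
1 + p_2 with p_2 the sum of the l_i^2. That D^(N) p_2 is bounded by a multiple of
1 + p_2 is not visible from the rates, which are of order p_2 and do not balance
coordinate by coordinate; it follows from computing with generalized Vandermonde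
determinants: V (D^(N) p_2) is a combination of V, V p_1, V p_1^2 and V p_2
([DN_gen_square]).

The determinantal formula is then an instance of uniqueness: the determinant
satisfies the backward equation because each P_1(t; ., n_j) does, it is bounded
since the dimension is bounded below, and it is the identity at time 0
([pN_det]).

For the Feller property it suffices to treat single entries
([semigroup_apply_approx]). Comparison with K t gives Lipschitz continuity in t,
uniformly in the starting point ([solution_lipschitz]). Comparison with
e^{kt} / (1 + x^2) shows that P_1(t; x, y) tends to 0 as x grows, and in the
determinant this makes a whole row small ([pN_decay]). *)

(** * Calculus of finite sums and products *)

Section PointwiseCalculus.
Context {R : realType}.
Implicit Types (f g : R -> R) (t : R).

Lemma is_derive_add f g t a b :
  is_derive t 1 f a -> is_derive t 1 g b ->
  is_derive t 1 (fun x => f x + g x) (a + b).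
Proof. by move=> df dg; exact: (@is_deriveD _ _ _ f g). Qed.

Lemma is_derive_mul f g t a b :
  is_derive t 1 f a -> is_derive t 1 g b ->
  is_derive t 1 (fun x => f x * g x) (a * g t + f t * b).
Proof.
move=> df dg.
have -> : a * g t + f t * b = f t *: b + g t *: a.
  by rewrite /GRing.scale /= addrC [a * _]mulrC.
exact: (@is_deriveM _ _ f g).
Qed.

Lemma is_derive_cmul (c : R) f t a :
  is_derive t 1 f a -> is_derive t 1 (fun x => c * f x) (c * a).
Proof. by move=> df; exact: (@is_deriveZ _ _ _ f c). Qed.

Lemma is_derive_const (c t : R) : is_derive t 1 (fun _ : R => c) 0.
Proof. exact: (@is_derive_cst). Qed.

Lemma is_derive_bigsum (I : Type) (r : seq I) (F : I -> R -> R) (F' : I -> R) t :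
  (forall i, is_derive t 1 (F i) (F' i)) ->
  is_derive t 1 (fun x => \sum_(i <- r) F i x) (\sum_(i <- r) F' i).
Proof.
move=> dF; elim: r => [|i r IHr].
  rewrite big_nil (_ : (fun _ => _) = (fun=> 0)); first exact: is_derive_const.
  by apply/funext => x; rewrite big_nil.
rewrite big_cons (_ : (fun _ => _) = (fun x => F i x + \sum_(j <- r) F j x)).
  exact: is_derive_add.
by apply/funext => x; rewrite big_cons.
Qed.

Lemma is_derive_expRM (k t : R) :
  is_derive t 1 (fun x : R => expR (x * k)) (k * expR (t * k)).
Proof.
have dk : is_derive t 1 (fun x : R => x * k) k.
  have := is_derive_mul (@is_derive_id _ _ t 1) (is_derive_const k t).
  by rewrite mul1r mulr0 addr0.
rewrite [X in is_derive _ _ _ X]mulrC.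
exact: (@is_derive1_comp _ expR (fun x => x * k) t).
Qed.

Lemma continuous_bigsum (I : Type) (r : seq I) (F : I -> R -> R) :
  (forall i, continuous (F i)) -> continuous (fun x => \sum_(i <- r) F i x).
Proof.
move=> cF; elim: r => [|i r IHr] t.
  rewrite (_ : (fun _ => _) = (fun=> 0)); first exact: cst_continuous.
  by apply/funext => x; rewrite big_nil.
rewrite (_ : (fun _ => _) = (fun x => F i x + \sum_(j <- r) F j x)).
  by apply: cvgD; [exact: cF|exact: IHr].
by apply/funext => x; rewrite big_cons.
Qed.

Lemma continuous_cmul (c : R) f : continuous f -> continuous (fun x => c * f x).
Proof. by move=> cf t; apply: cvgM; [exact: cvg_cst|exact: cf]. Qed.

End PointwiseCalculus.

(** * The Duhamel integral *)

Section Duhamel.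
Context {R : realType}.
Notation mu := (@lebesgue_measure R).

(** The solution of w' = k w + g with w(0) = 0. With k a diagonal rate and g
the inflow from the neighbours, both the recursion over the number of jumps
and the fixed-point equation of the minimal solution have this shape. *)
Definition duhamel (k : R) (g : R -> R) (t : R) : R :=
  expR (t * k) * \int[mu]_(s in `[0, t]) (expR (- (s * k)) * g s).

Lemma continuous_integrable_itv (h : R -> R) (a b : R) :
  continuous h -> mu.-integrable `[a, b] (EFin \o h).
Proof.
move=> ch; apply: continuous_compact_integrable; first exact: segment_compact.
exact: continuous_subspaceT.
Qed.

Lemma continuous_expRM (k : R) : continuous (fun t : R => expR (t * k)).
Proof.
move=> t; apply: (@continuous_comp _ _ _ (fun t : R => t * k) expR).
  exact: mulrr_continuous.
exact: continuous_expR.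
Qed.

Lemma continuous_expRNM (k : R) : continuous (fun t : R => expR (- (t * k))).
Proof.
have -> : (fun t : R => expR (- (t * k))) = (fun t => expR (t * (- k))).
  by apply/funext => t; rewrite mulrN.
exact: continuous_expRM.
Qed.

(** The interval is empty for t < 0, so the integral vanishes there and is
continuous on the whole line; this spares one-sided statements at 0. *)
Lemma integral_continuous (h : R -> R) :
  (forall T, mu.-integrable `[0, T] (EFin \o h)) ->
  continuous (fun t : R => \int[mu]_(s in `[0, t]) h s).
Proof.
move=> ih t.
have [t0|t0|->] := ltgtP t 0.
- rewrite /continuous_at; have -> : \int[mu]_(s in `[0, t]) h s = 0.
    by rewrite set_itv_ge ?Rintegral_set0// bnd_simp -ltNge.
  apply: cvg_near_cst; near=> x.
  rewrite set_itv_ge ?Rintegral_set0// bnd_simp -ltNge.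
  by near: x; exact: lt_nbhsl.
- have t1 : 0 <= t + 1 by lra.
  have /continuous_within_itvP := parameterized_integral_continuous t1 (ih _).
  move=> /(_ (ltr_wpDl (ltW t0) ltr01)) [+ _ _].
  by apply; rewrite in_itv/= t0 ltrDl ltr01.
- rewrite /continuous_at set_itv1 Rintegral_set1.
  exact: (parameterized_integral_cvg_left (@ltr01 R) (ih 1)).
Unshelve. all: by end_near. Qed.

Lemma continuous_duhamel_gen (k : R) (g : R -> R) :
  (forall T, mu.-integrable `[0, T] (EFin \o (fun s => expR (- (s * k)) * g s))) ->
  continuous (duhamel k g).
Proof.
move=> ih t; apply: cvgM; first exact: continuous_expRM.
exact: integral_continuous.
Qed.

Lemma continuous_weight (k : R) (g : R -> R) : continuous g ->
  continuous (fun s : R => expR (- (s * k)) * g s).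
Proof. by move=> cg s; apply: cvgM; [exact: continuous_expRNM|exact: cg]. Qed.

Lemma continuous_duhamel (k : R) (g : R -> R) : continuous g ->
  continuous (duhamel k g).
Proof.
move=> cg; apply: continuous_duhamel_gen => T.
by apply: continuous_integrable_itv; exact: continuous_weight.
Qed.

Lemma is_derive_duhamel (k : R) (g : R -> R) (t : R) : continuous g -> 0 < t ->
  is_derive t 1 (duhamel k g) (k * duhamel k g t + g t).
Proof.
move=> cg t0.
have cw := @continuous_weight k g cg.
have [dI I'] := @continuous_FTC1_closed R _ 0 t (t + 1)
  (ltr_pwDr ltr01 (lexx _)) (continuous_integrable_itv _ _ cw) t0 (cw t).
have HI : is_derive t 1
    (fun x => \int[mu]_(s in `[0, x]) (expR (- (s * k)) * g s))
    (expR (- (t * k)) * g t).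
  by apply: DeriveDef => //; rewrite -derive1E.
apply: is_derive_eq (is_derive_mul (is_derive_expRM k t) HI) _.
rewrite /duhamel [expR _ * (_ * g t)]mulrA -expRD addrN expR0 mul1r.
by rewrite mulrA.
Qed.

Lemma duhamel_ge0 (k : R) (g : R -> R) (t : R) :
  (forall s, 0 <= s <= t -> 0 <= g s) -> 0 <= duhamel k g t.
Proof.
move=> g0; rewrite mulr_ge0 ?expR_ge0//; apply: Rintegral_ge0 => s /=.
by rewrite in_itv/= => st; rewrite mulr_ge0 ?expR_ge0 ?g0.
Qed.

Lemma le_duhamel (k : R) (g1 g2 : R -> R) (t : R) :
  continuous g1 -> continuous g2 ->
  (forall s, 0 <= s <= t -> g1 s <= g2 s) -> duhamel k g1 t <= duhamel k g2 t.
Proof.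
move=> c1 c2 g12; rewrite ler_wpM2l ?expR_ge0//; apply: le_Rintegral => //.
- by apply: continuous_integrable_itv; exact: continuous_weight.
- by apply: continuous_integrable_itv; exact: continuous_weight.
by move=> s /=; rewrite in_itv/= => st; rewrite ler_wpM2l ?expR_ge0 ?g12.
Qed.

Lemma duhamelD (k : R) (g1 g2 : R -> R) (t : R) :
  continuous g1 -> continuous g2 ->
  duhamel k (fun s => g1 s + g2 s) t = duhamel k g1 t + duhamel k g2 t.
Proof.
move=> c1 c2; rewrite /duhamel -mulrDr; congr (_ * _); rewrite -RintegralD//.
- by apply: eq_Rintegral => s _; rewrite mulrDr.
- by apply: continuous_integrable_itv; exact: continuous_weight.
- by apply: continuous_integrable_itv; exact: continuous_weight.
Qed.

(** This is the probability that an exponential clock of rate -k rings before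
time t; it is what keeps the partial sums of the minimal solution at most 1. *)
Lemma duhamel_cst (k t : R) : 0 <= t -> duhamel k (fun=> - k) t = 1 - expR (t * k).
Proof.
rewrite le_eqVlt => /predU1P[<-|t0].
  by rewrite /duhamel mul0r expR0 set_itv1 Rintegral_set1 mulr0 subrr.
rewrite /duhamel.
have cE : continuous (fun s : R => expR (- (s * k))) by exact: continuous_expRNM.
have dE (s : R) :
    is_derive s 1 (fun s : R => expR (- (s * k))) (expR (- (s * k)) * - k).
  have -> : (fun s : R => expR (- (s * k))) = (fun s => expR (s * - k)).
    by apply/funext => x; rewrite mulrN.
  by rewrite -mulrN mulrC; exact: is_derive_expRM.
have := @continuous_FTC2 R (fun s => expR (- (s * k)) * - k)
  (fun s => expR (- (s * k))) 0 t t0.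
rewrite /Rintegral => ->; rewrite ?mul0r ?oppr0 ?expR0 /=.
- by rewrite mulrBr -expRD addrN expR0 mulr1.
- apply: continuous_subspaceT => s; apply: cvgM; [exact: cE|exact: cvg_cst].
- split.
  + by move=> s _; have [] := dE s.
  + exact/cvg_at_right_filter/cE.
  + exact/cvg_at_left_filter/cE.
- by move=> s _; rewrite derive1E; have [_ ->] := dE s.
Qed.

(** The substitution s = t - tau turns the convolution by which the minimal
solution is defined into the Duhamel integral. *)
Lemma duhamel_convolution (k : R) (g : R -> R) (t : R) : continuous g -> 0 <= t ->
  (\int[mu]_(tau in `[0%R, t]) ((expR (tau * k))%:E * (g (t - tau))%:E) =
   (duhamel k g t)%:E)%E.
Proof.
move=> cg t0.
have cw : continuous (fun s : R => expR (s * k) * g (t - s)).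
  move=> s; apply: cvgM; first exact: continuous_expRM.
  apply: (@continuous_comp _ _ _ (fun s : R => t - s) g); last exact: cg.
  by apply: cvgB; [exact: cvg_cst|exact: cvg_id].
transitivity (\int[mu]_(x in `[(t - t)%R, (t - 0)%R])
    ((expR (x * k) * g (t - x))%:E))%E.
  by rewrite subrr subr0; apply: eq_integral => s _; rewrite EFinM.
have ds (s : R) : is_derive s 1 (fun s : R => t - s) (-1).
  have := is_derive_add (is_derive_const t s) (@is_deriveNid _ _ s 1).
  by rewrite add0r.
have D1 : derive1 (fun s : R => t - s) = cst (-1).
  by apply/funext => s; rewrite derive1E; have [_ ->] := ds s.
rewrite (@integration_by_substitution_decreasing R (fun s => t - s)
  (fun x => expR (x * k) * g (t - x)) 0 t t0) //.
- rewrite /duhamel EFinM fineK ?integrable_fin_num//; last first.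
    by apply: continuous_integrable_itv; exact: continuous_weight.
  rewrite -integralZl//; last first.
    by apply: continuous_integrable_itv; exact: continuous_weight.
  apply: eq_integral => s _; rewrite -EFinM; congr EFin.
  by rewrite /= !fctE D1 /= opprK mulr1 subKr mulrA -expRD mulrBl.
- by move=> x y _ _ xy; rewrite ltrD2l ltrN2.
- by rewrite D1 => s _; exact: cst_continuous.
- by rewrite D1; exact: is_cvg_cst.
- by rewrite D1; exact: is_cvg_cst.
- have cs : continuous (fun s : R => t - s).
    by move=> s; apply: cvgB; [exact: cvg_cst|exact: cvg_id].
  split.
  + by move=> s _; have [] := ds s.
  + exact/cvg_at_right_filter/cs.
  + exact/cvg_at_left_filter/cs.
- exact: continuous_subspaceT.
Qed.

End Duhamel.

Section DuhamelLimit.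
Context {R : realType}.
Notation mu := (@lebesgue_measure R).
Variables (k M : R) (g_ : nat -> R -> R) (g : R -> R).
Hypothesis g_continuous : forall n, continuous (g_ n).
Hypothesis g_cvg : forall s, 0 <= s -> g_ ^~ s @ \oo --> g s.
Hypothesis g_bounded : forall n s, 0 <= s -> `|g_ n s| <= M.

(** Dominated convergence. At this stage the limit is only known to be bounded
and measurable; this suffices to make its Duhamel integral continuous. *)
Let weighted_cvg t :
  mu.-integrable `[0, t] (EFin \o (fun s => expR (- (s * k)) * g s)) /\
  (\int[mu]_(s in `[0%R, t]) (expR (- (s * k)) * g_ n s)%:E @[n --> \oo] -->
   \int[mu]_(s in `[0%R, t]) (expR (- (s * k)) * g s)%:E)%E.
Proof.
have cw n : continuous (fun s : R => expR (- (s * k)) * g_ n s).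
  exact: continuous_weight.
have mw n : measurable_fun `[0%R, t] (fun s : R => expR (- (s * k)) * g_ n s).
  by have /measurable_int /measurable_EFinP := continuous_integrable_itv 0 t (cw n).
have wcvg s : [set` `[0, t]] s ->
    expR (- (s * k)) * g_ n s @[n --> \oo] --> expR (- (s * k)) * g s.
  rewrite /= in_itv/= => /andP[s0 _].
  by apply: cvgM; [exact: cvg_cst|exact: g_cvg].
have [||||| ? _ ?] := @dominated_convergence _ _ R mu _ (measurable_itv `[0, t])
   (fun n s => (expR (- (s * k)) * g_ n s)%:E)
   (fun s => (expR (- (s * k)) * g s)%:E)
   (fun s => (expR (- (s * k)) * M)%:E) => //.
- by move=> n; have /measurable_EFinP := mw n.
- by have /measurable_EFinP := measurable_fun_cvg mw wcvg.
- apply: aeW => s ts; apply: cvg_EFin; last exact: wcvg.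
  by apply: nearW.
- apply: continuous_integrable_itv; apply: continuous_weight.
  exact: cst_continuous.
- apply: aeW => s n; rewrite /= in_itv/= => /andP[s0 _].
  rewrite lee_fin normrM ger0_norm ?expR_ge0//.
  by rewrite ler_wpM2l ?expR_ge0 ?g_bounded.
Qed.

Lemma limit_weight_integrable t :
  mu.-integrable `[0, t] (EFin \o (fun s => expR (- (s * k)) * g s)).
Proof. by have [] := weighted_cvg t. Qed.

Lemma cvg_duhamel t : duhamel k (g_ n) t @[n --> \oo] --> duhamel k g t.
Proof.
apply: cvgM; first exact: cvg_cst.
have [ig cg] := weighted_cvg t.
apply: fine_cvg; rewrite fineK; first exact: cg.
exact: integrable_fin_num.
Qed.

Lemma continuous_duhamel_limit : continuous (duhamel k g).
Proof. exact: continuous_duhamel_gen limit_weight_integrable. Qed.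

End DuhamelLimit.

(** * The minimal solution of a chain with finite rows *)

Section FiniteSupportSums.
Context {R : realType} {T : choiceType}.

Lemma esum_seq (D : set T) (r : seq T) (f : T -> R) : uniq r ->
  (forall x, x \in r -> D x) -> (forall x, D x -> x \notin r -> f x = 0) ->
  (forall x, D x -> 0 <= f x) ->
  (\esum_(x in D) (f x)%:E = (\sum_(x <- r) f x)%:E)%E.
Proof.
move=> ur rD f0 fge0.
rewrite (esumID [set` r])//.
rewrite [X in (_ + X)%E]esum1 ?adde0; last first.
  by move=> x [Dx xr]; rewrite f0//; apply/negP.
rewrite (_ : D `&` _ = [set` r]); last first.
  by apply/seteqP; split => [x []//|x xr]; split => //; exact: rD.
rewrite esum_fset.
- by rewrite -fsbig_seq// sumEFin.
- exact: finite_seq.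
- by move=> x; rewrite inE => /rD Dx; rewrite lee_fin fge0.
Qed.

End FiniteSupportSums.

Section RowFinite.
Context {R : realType} {E : countType}.

(** From each state only finitely many others can be reached in one jump. With
the reachable states listed by [nb], all sums over target states become finite
sums, which can be differentiated term by term. *)
Record row_finite (Q : E -> E -> R) (nb : E -> seq E) : Prop := RowFinite {
  nb_uniq : forall a, uniq (nb a);
  nb_irrefl : forall a, a \notin nb a;
  rate_off_nb : forall a b, b != a -> b \notin nb a -> Q a b = 0;
  rate_ge0 : forall a b, a != b -> 0 <= Q a b;
  rate_diag : forall a, Q a a = - \sum_(c <- nb a) Q a c }.

Variables (Q : E -> E -> R) (nb : E -> seq E).
Hypothesis Qrf : row_finite Q nb.

Definition inflow (f : E -> R) a := \sum_(c <- nb a) Q a c * f c.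

Definition gen (f : E -> R) a := Q a a * f a + inflow f a.

Lemma nb_neq a c : c \in nb a -> c != a.
Proof. by apply: contraTneq => ->; exact: (nb_irrefl Qrf). Qed.

Lemma nb_rate_ge0 a c : c \in nb a -> 0 <= Q a c.
Proof. by move=> /nb_neq ca; rewrite (rate_ge0 Qrf)// eq_sym. Qed.

Lemma le_inflow f g a : (forall c, f c <= g c) -> inflow f a <= inflow g a.
Proof.
move=> fg; rewrite /inflow big_seq [leRHS]big_seq; apply: ler_sum => c ca.
by rewrite ler_wpM2l ?nb_rate_ge0.
Qed.

Lemma inflow_ge0 f a : (forall c, 0 <= f c) -> 0 <= inflow f a.
Proof.
move=> f0; rewrite /inflow big_seq; apply: sumr_ge0 => c ca.
by rewrite mulr_ge0 ?nb_rate_ge0.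
Qed.

Lemma inflow_cst x a : inflow (fun=> x) a = - Q a a * x.
Proof. by rewrite /inflow -mulr_suml (rate_diag Qrf) opprK. Qed.

Lemma gen_cst x a : gen (fun=> x) a = 0.
Proof. by rewrite /gen inflow_cst mulNr subrr. Qed.

Lemma gen_add f g a : gen (fun c => f c + g c) a = gen f a + gen g a.
Proof.
rewrite /gen mulrDr addrACA; congr (_ + _); rewrite /inflow -big_split /=.
by apply: eq_bigr => c _; rewrite mulrDr.
Qed.

Lemma gen_cmul x f a : gen (fun c => x * f c) a = x * gen f a.
Proof.
rewrite /gen mulrDr mulrCA; congr (_ + _); rewrite /inflow big_distrr /=.
by apply: eq_bigr => c _; rewrite mulrCA.
Qed.

Lemma gen_bigsum (I : Type) (r : seq I) (F : I -> E -> R) a :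
  gen (fun c => \sum_(i <- r) F i c) a = \sum_(i <- r) gen (F i) a.
Proof.
elim: r => [|i r IHr].
  rewrite big_nil -[RHS](gen_cst 0 a); congr gen.
  by apply/funext => c; rewrite big_nil.
rewrite big_cons -IHr -gen_add; congr gen.
by apply/funext => c; rewrite big_cons.
Qed.

Lemma row_finite_rate_matrix : is_rate_matrix Q.
Proof.
split; first exact: (rate_ge0 Qrf).
move=> a; rewrite (rate_diag Qrf) opprK; apply: esum_seq.
- exact: (nb_uniq Qrf).
- by move=> c /nb_neq /eqP.
- by move=> c /eqP ca /(rate_off_nb Qrf); exact.
- by move=> c /eqP ca; rewrite (rate_ge0 Qrf)// eq_sym.
Qed.

(** The entry P^[n](t; a, b) as a real number, in Duhamel form and therefore
continuous in t on the whole line. *)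
Fixpoint jump_term (b : E) (n : nat) (t : R) (a : E) : R :=
  if n is m.+1 then duhamel (Q a a) (fun s => inflow (jump_term b m s) a) t
  else expR (t * Q a a) * (a == b)%:R.

Lemma continuous_jump_term b n a : continuous (jump_term b n ^~ a).
Proof.
elim: n a => [|n IHn] a /=.
  by move=> t; apply: cvgM; [exact: continuous_expRM|exact: cvg_cst].
apply: continuous_duhamel; apply: continuous_bigsum => c.
exact: continuous_cmul.
Qed.

Lemma jump_term_ge0 b n t a : 0 <= jump_term b n t a.
Proof.
elim: n t a => [|n IHn] t a /=; first by rewrite mulr_ge0 ?expR_ge0.
by apply: duhamel_ge0 => s _; exact: inflow_ge0.
Qed.

Lemma minimal_solution_termE b n t a : 0 <= t ->
  minimal_solution_term Q n t a b = (jump_term b n t a)%:E.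
Proof.
elim: n t a => [|n IHn] t a t0 /=.
  by case: eqP => _; rewrite ?mulr1n ?mulr0n ?mulr1 ?mulr0.
rewrite -duhamel_convolution//; last first.
  apply: continuous_bigsum => c; apply: continuous_cmul.
  exact: continuous_jump_term.
apply: eq_integral => s; rewrite inE/= in_itv/= => /andP[s0 st].
congr (_ * _)%E; under eq_esum do rewrite IHn ?subr_ge0// -EFinM.
apply: esum_seq.
- exact: (nb_uniq Qrf).
- by move=> c /nb_neq /eqP.
- by move=> c /eqP ca /(rate_off_nb Qrf) -> //; rewrite mul0r.
- by move=> c /eqP ca; rewrite mulr_ge0 ?jump_term_ge0// (rate_ge0 Qrf)// eq_sym.
Qed.

Definition partial_solution b n t a := \sum_(k < n) jump_term b k t a.

Lemma continuous_partial_solution b n a :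
  continuous (partial_solution b n ^~ a).
Proof. by apply: continuous_bigsum => k; exact: continuous_jump_term. Qed.

Lemma partial_solution_ge0 b n t a : 0 <= partial_solution b n t a.
Proof. by apply: sumr_ge0 => k _; exact: jump_term_ge0. Qed.

Lemma continuous_inflow_partial b n a :
  continuous (fun s => inflow (partial_solution b n s) a).
Proof.
apply: continuous_bigsum => c; apply: continuous_cmul.
exact: continuous_partial_solution.
Qed.

Lemma partial_solutionS b n t a : partial_solution b n.+1 t a =
  expR (t * Q a a) * (a == b)%:R +
  duhamel (Q a a) (fun s => inflow (partial_solution b n s) a) t.
Proof.
elim: n => [|n IHn].
  rewrite /partial_solution big_ord_recl big_ord0 /=; congr (_ + _).
  rewrite /duhamel (_ : (fun s => _) = cst 0) ?Rintegral_cst//= ?mul0r ?mulr0//.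
  apply/funext => s /=; rewrite /inflow big1 ?mulr0// => c _.
  by rewrite big_ord0 mulr0.
rewrite {1}/partial_solution big_ord_recr /= -/(partial_solution _ _ _ _) IHn.
rewrite -addrA -duhamelD.
- congr (_ + duhamel _ _ _); apply/funext => s.
  rewrite /inflow -big_split /=; apply: eq_bigr => c _.
  by rewrite -mulrDr /partial_solution big_ord_recr.
- exact: continuous_inflow_partial.
- apply: continuous_bigsum => c; apply: continuous_cmul.
  exact: continuous_jump_term.
Qed.

(** By induction on the number of jumps: the inflow is at most the total jump
rate, so by [duhamel_cst] the paths that jump have mass at most 1 - e^{-qt},
and e^{-qt} is the mass of the paths that do not. *)
Lemma partial_solution_le1 b n t a : 0 <= t -> partial_solution b n t a <= 1.
Proof.
elim: n t a => [|n IHn] t a t0; first by rewrite /partial_solution big_ord0.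
rewrite partial_solutionS.
have : duhamel (Q a a) (fun s => inflow (partial_solution b n s) a) t <=
       1 - expR (t * Q a a).
  rewrite -duhamel_cst//; apply: le_duhamel.
  - exact: continuous_inflow_partial.
  - exact: cst_continuous.
  - move=> s /andP[s0 _]; rewrite -[leRHS]mulr1 -inflow_cst /inflow.
    rewrite big_seq [leRHS]big_seq; apply: ler_sum => c ca.
    by rewrite ler_wpM2l ?nb_rate_ge0 ?IHn.
have := expR_ge0 (t * Q a a).
by case: (a == b) => /=; rewrite ?mulr1 ?mulr0; lra.
Qed.

Lemma partial_solution_nd b t a :
  {homo (fun n => partial_solution b n t a) : m n / (m <= n)%N >-> m <= n}.
Proof.
apply/nondecreasing_seqP => n; rewrite /partial_solution big_ord_recr /=.
by rewrite lerDl jump_term_ge0.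
Qed.

Definition solution b t a : R := limn (fun n => partial_solution b n t a).

Lemma partial_solution_cvg b t a : 0 <= t ->
  partial_solution b n t a @[n --> \oo] --> solution b t a.
Proof.
move=> t0; apply: nondecreasing_is_cvgn; first exact: partial_solution_nd.
by exists 1 => _ [n _ <-]; exact: partial_solution_le1.
Qed.

Lemma solution_ge0 b t a : 0 <= t -> 0 <= solution b t a.
Proof.
move=> t0; apply: limr_ge; first exact/cvgP/partial_solution_cvg.
by apply: nearW => n; exact: partial_solution_ge0.
Qed.

Lemma solution_le1 b t a : 0 <= t -> solution b t a <= 1.
Proof.
move=> t0; apply: limr_le; first exact/cvgP/partial_solution_cvg.
by apply: nearW => n; exact: partial_solution_le1.
Qed.

Lemma minimal_solutionE b t a : 0 <= t ->
  minimal_solution Q t a b = (solution b t a)%:E.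
Proof.
move=> t0; rewrite /minimal_solution -EFin_lim; last first.
  exact/cvgP/partial_solution_cvg.
congr (limn _); apply/funext => n /=; rewrite big_mkord -sumEFin.
by apply: eq_bigr => k _; exact: minimal_solution_termE.
Qed.

Lemma markov_semigroupE b t a : 0 <= t ->
  markov_semigroup Q t a b = solution b t a.
Proof. by move=> t0; rewrite /markov_semigroup minimal_solutionE. Qed.

End RowFinite.

(** * The backward equation *)

Section BackwardEquation.
Context {R : realType} {E : countType} (Q : E -> E -> R) (nb : E -> seq E).
Hypothesis Qrf : row_finite Q nb.
Notation inflow := (inflow Q nb).
Notation gen := (gen Q nb).
Notation solution := (solution Q nb).
Notation partial_solution := (partial_solution Q nb).

(** Continuity is asked on the whole line and the equation for t > 0 only, since
the solutions may have a corner at time 0. *)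
Definition backward (w : R -> E -> R) := forall a, continuous (w ^~ a) /\
  forall t : R, 0 < t -> is_derive t 1 (w ^~ a) (gen (w t) a).

Definition supersolution (w : R -> E -> R) := forall a, continuous (w ^~ a) /\
  forall t : R, 0 < t -> exists2 d, is_derive t 1 (w ^~ a) d & gen (w t) a <= d.

Let inflow_cvg b a s : 0 <= s ->
  inflow (partial_solution b n s) a @[n --> \oo] --> inflow (solution b s) a.
Proof.
move=> s0; rewrite /inflow; elim: (nb a) => [|c r IHr].
  by rewrite big_nil; under eq_fun do rewrite big_nil; exact: cvg_cst.
rewrite big_cons; under eq_fun do rewrite big_cons.
apply: cvgD => //; apply: cvgM; first exact: cvg_cst.
exact: partial_solution_cvg.
Qed.

Let inflow_bounded b a n s : 0 <= s ->
  `|inflow (partial_solution b n s) a| <= - Q a a.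
Proof.
move=> s0; rewrite ger0_norm; last first.
  by apply: inflow_ge0 => // c; exact: partial_solution_ge0.
rewrite -[leRHS]mulr1 -(inflow_cst Qrf); apply: le_inflow => // c.
exact: partial_solution_le1.
Qed.

Let inflow_continuous b a n :
  continuous (fun s => inflow (partial_solution b n s) a).
Proof. exact: continuous_inflow_partial. Qed.

(** The limit of [partial_solutionS] as the number of jumps grows. *)
Lemma solution_mild b t a : solution b t a = expR (t * Q a a) * (a == b)%:R +
  duhamel (Q a a) (fun s => inflow (solution b s) a) t.
Proof.
apply/cvg_lim => //; rewrite -cvg_shiftS /=.
under eq_fun do rewrite partial_solutionS//.
apply: cvgD; first exact: cvg_cst.
apply: (@cvg_duhamel _ _ (- Q a a)
  (fun n s => inflow (partial_solution b n s) a)); first exact: inflow_continuous.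
- by move=> s; exact: inflow_cvg.
- by move=> n s; exact: inflow_bounded.
Qed.

Lemma continuous_solution b a : continuous (solution b ^~ a).
Proof.
rewrite (_ : _ ^~ _ = fun t => expR (t * Q a a) * (a == b)%:R +
  duhamel (Q a a) (fun s => inflow (solution b s) a) t); last first.
  by apply/funext => t; exact: solution_mild.
move=> t; apply: cvgD.
  by apply: cvgM; [exact: continuous_expRM|exact: cvg_cst].
apply: (@continuous_duhamel_limit _ _ (- Q a a)
  (fun n s => inflow (partial_solution b n s) a)); first exact: inflow_continuous.
- by move=> s; exact: inflow_cvg.
- by move=> n s; exact: inflow_bounded.
Qed.

(** The solution is bounded and measurable, hence its Duhamel integral is
continuous, hence by the mild equation so is the solution itself; now the
integrand is continuous and the mild equation can be differentiated. *)
Lemma solution_backward b : backward (solution b).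
Proof.
move=> a; split; first exact: continuous_solution.
move=> t t0.
have -> : solution b ^~ a = fun t => (a == b)%:R * expR (t * Q a a) +
    duhamel (Q a a) (fun s => inflow (solution b s) a) t.
  by apply/funext => s; rewrite solution_mild mulrC.
have ci : continuous (fun s => inflow (solution b s) a).
  apply: continuous_bigsum => c; apply: continuous_cmul.
  exact: continuous_solution.
apply: is_derive_eq (is_derive_add
  (is_derive_cmul (a == b)%:R (is_derive_expRM (Q a a) t))
  (is_derive_duhamel (Q a a) ci t0)) _.
rewrite /gen solution_mild [in RHS]mulrDr addrA.
by congr (_ + _ + _); rewrite mulrCA [expR _ * _]mulrC.
Qed.

Lemma solution0 b a : solution b 0 a = (a == b)%:R.
Proof.
by rewrite solution_mild mul0r expR0 mul1r /duhamel set_itv1 Rintegral_set1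
  mulr0 addr0.
Qed.

Lemma backward_supersolution w : backward w -> supersolution w.
Proof.
move=> bw a; split=> [|t t0]; first exact: (bw a).1.
by exists (gen (w t) a) => //; exact: (bw a).2.
Qed.

Lemma supersolution_add w1 w2 : supersolution w1 -> supersolution w2 ->
  supersolution (fun t a => w1 t a + w2 t a).
Proof.
move=> s1 s2 a; have [c1 d1] := s1 a; have [c2 d2] := s2 a; split.
  by move=> t; apply: cvgD; [exact: c1|exact: c2].
move=> t t0; have [e1 D1 g1] := d1 t t0; have [e2 D2 g2] := d2 t t0.
exists (e1 + e2); first exact: is_derive_add.
by rewrite gen_add lerD.
Qed.

Lemma backward_add w1 w2 : backward w1 -> backward w2 ->
  backward (fun t a => w1 t a + w2 t a).
Proof.
move=> s1 s2 a; have [c1 d1] := s1 a; have [c2 d2] := s2 a; split.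
  by move=> t; apply: cvgD; [exact: c1|exact: c2].
by move=> t t0; rewrite gen_add; apply: is_derive_add; [exact: d1|exact: d2].
Qed.

Lemma backward_cmul x w : backward w -> backward (fun t a => x * w t a).
Proof.
move=> s a; have [c d] := s a; split; first exact: continuous_cmul.
by move=> t t0; rewrite gen_cmul; apply: is_derive_cmul; exact: d.
Qed.

Lemma backward_cst x : backward (fun _ _ => x).
Proof.
move=> a; split; first exact: cst_continuous.
by move=> t t0; rewrite (gen_cst Qrf); exact: is_derive_const.
Qed.

Lemma backward_bigsum (I : Type) (r : seq I) (w : I -> R -> E -> R) :
  (forall i, backward (w i)) -> backward (fun t a => \sum_(i <- r) w i t a).
Proof.
move=> bw a; split; first by apply: continuous_bigsum => i; exact: (bw i a).1.
move=> t t0; rewrite (gen_bigsum Qrf); apply: is_derive_bigsum => i.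
exact: (bw i a).2.
Qed.

Lemma backward_shift (h : R) w : 0 <= h -> backward w ->
  backward (fun t a => w (t + h) a).
Proof.
move=> h0 s a; have [c d] := s a; split.
  move=> t; apply: (@continuous_comp _ _ _ (fun t : R => t + h) (w ^~ a)).
    by apply: cvgD; [exact: cvg_id|exact: cvg_cst].
  exact: c.
move=> t t0; have dt : is_derive t 1 (fun t : R => t + h) 1.
  have := is_derive_add (@is_derive_id _ _ t 1) (is_derive_const h t).
  by rewrite addr0.
have := @is_derive1_comp _ (w ^~ a) (fun t : R => t + h) t _ _
  (d _ (ltr_wpDr h0 t0)) dt.
by rewrite mulr1.
Qed.

Lemma supersolution_exp c (x : R) F : 0 <= x -> (forall a, gen F a <= c * F a) ->
  supersolution (fun t a => x * (expR (t * c) * F a)).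
Proof.
move=> x0 gF a; split.
  apply: continuous_cmul => t; apply: cvgM; last exact: cvg_cst.
  exact: continuous_expRM.
move=> t t0; exists (x * (c * expR (t * c) * F a)).
  apply: is_derive_cmul.
  have := is_derive_mul (is_derive_expRM c t) (is_derive_const (F a) t).
  by rewrite mulr0 addr0.
by rewrite !gen_cmul ler_wpM2l// [c * _]mulrC -mulrA ler_wpM2l ?expR_ge0.
Qed.

End BackwardEquation.

(** * Comparison principle, uniqueness and regularity *)

Section Comparison.
Context {R : realType} {E : countType} (Q : E -> E -> R) (nb : E -> seq E).
Hypothesis Qrf : row_finite Q nb.
Notation inflow := (inflow Q nb).
Notation gen := (gen Q nb).
Notation solution := (solution Q nb).
Notation backward := (backward Q nb).
Notation supersolution := (supersolution Q nb).

Lemma gen_indicator b a : gen (fun c => (c == b)%:R) a = Q a b.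
Proof.
rewrite /gen /inflow.
have -> : \sum_(c <- nb a) Q a c * (c == b)%:R = (b \in nb a)%:R * Q a b.
  rewrite (eq_bigr (fun c => if c == b then Q a b else 0)); last first.
    by move=> c _; have [->|_] := eqVneq c b; rewrite ?mulr1 ?mulr0.
  rewrite -big_mkcond big_const_seq iter_addr_0 mulr_natl.
  by rewrite -(count_uniq_mem _ (nb_uniq Qrf a)).
have [->|ab] := eqVneq a b.
  by rewrite (negbTE (nb_irrefl Qrf b)) mul0r mulr1 addr0.
have [bn|bn] := boolP (b \in nb a); first by rewrite mul1r mulr0 add0r.
by rewrite mulr0 mul0r addr0 (rate_off_nb Qrf)// eq_sym.
Qed.

Lemma rate_diag_le0 a : Q a a <= 0.
Proof.
rewrite (rate_diag Qrf) oppr_le0 big_seq; apply: sumr_ge0 => c ca.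
exact: nb_rate_ge0 ca.
Qed.

(** Let q = - Q a a. As long as w >= m everywhere, the inflow is at least q m, so
e^{qt} (w - m) is nondecreasing in t; compare its values at 0 and t. *)
Lemma supersolution_lower_bound w a t m : supersolution w -> m <= 0 ->
  (forall s b, 0 <= s <= t -> m <= w s b) -> 0 <= w 0 a -> 0 <= t ->
  m * (1 - expR (t * Q a a)) <= w t a.
Proof.
move=> sw m0 mw w0; rewrite le_eqVlt => /predU1P[<-|t0].
  by rewrite mul0r expR0 subrr mulr0.
have [cw dw] := sw a.
pose h (s : R) := expR (s * - Q a a) * (w s a - m).
have dh (s : R) : 0 < s -> exists2 d, is_derive s 1 (w ^~ a) d &
    gen (w s) a <= d /\ is_derive s 1 h
      (- Q a a * expR (s * - Q a a) * (w s a - m) + expR (s * - Q a a) * d).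
  move=> s0; have [d D gd] := dw s s0; exists d => //; split => //.
  apply: is_derive_mul; first exact: is_derive_expRM.
  by have := is_derive_add D (is_derive_const (- m) s); rewrite addr0.
have ch : {within `[0, t], continuous h}.
  apply: continuous_subspaceT => s; apply: cvgM; first exact: continuous_expRM.
  by apply: cvgB; [exact: cw|exact: cvg_cst].
have : h 0 <= h t.
  apply: (@ger0_derive1_le_cc _ h 0 t) => //; rewrite ?in_itv/= ?lexx ?ltW//.
    by move=> s; rewrite in_itv/= => /andP[s0 _]; have [d _ [_ []]] := dh s s0.
  move=> s; rewrite in_itv/= => /andP[s0 st].
  have [d _ [gd D]] := dh s s0; rewrite derive1E; case: D => _ ->.
  have im : - Q a a * m <= inflow (w s) a.
    rewrite -(inflow_cst Qrf); apply: le_inflow => // c.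
    by apply: mw; rewrite !ltW.
  move: gd; rewrite /gen => gd.
  have -> : - Q a a * expR (s * - Q a a) * (w s a - m) + expR (s * - Q a a) * d =
    expR (s * - Q a a) * (d - Q a a * w s a + Q a a * m) by ring.
  by rewrite mulr_ge0 ?expR_ge0//; lra.
rewrite /h mul0r expR0 mul1r mulrN => ht.
have := expR_gt0 (t * Q a a); set e := expR (t * Q a a) => e0.
have ee : e * expR (- (t * Q a a)) = 1 by rewrite /e -expRD addrN expR0.
have := ler_wpM2l (ltW e0) ht; rewrite mulrA ee mul1r.
have : 0 <= e * w 0 a by rewrite mulr_ge0 ?(ltW e0).
by rewrite -/e mulrBr; lra.
Qed.

(** Suppose the infimum m of w is negative. Where w < 0 the jump rates are at most
K, so the previous bound gives w >= m (1 - e^{-TK}) everywhere, which is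
strictly above m. *)
Lemma supersolution_ge0 w T M K : supersolution w ->
  (forall t a, 0 <= t <= T -> - M <= w t a) ->
  (forall t a, 0 <= t <= T -> w t a < 0 -> - Q a a <= K) ->
  (forall a, 0 <= w 0 a) ->
  forall t a, 0 <= t <= T -> 0 <= w t a.
Proof.
move=> sw Mw Kw w0 t0 a0 t0T.
pose S := [set x | exists t a, 0 <= t <= T /\ x = w t a].
have S0 : S !=set0 by exists (w t0 a0), t0, a0.
have lS : has_lbound S by exists (- M) => _ [t [a [tT ->]]]; exact: Mw.
have infS t a : 0 <= t <= T -> inf S <= w t a.
  by move=> tT; apply: ge_inf => //; exists t, a.
rewrite leNgt; apply/negP => wneg.
have m0 : inf S < 0 by exact: le_lt_trans (infS _ _ t0T) wneg.
have : inf S * (1 - expR (- (T * K))) <= inf S.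
  apply: lb_le_inf => // _ [t [a [tT ->]]].
  have /andP[t_ge0 t_leT] := tT.
  have [wp|wn] := leP 0 (w t a).
    rewrite (le_trans _ wp)// mulr_le0_ge0 ?(ltW m0)// subr_ge0 expR_le1//.
    have qK := Kw _ _ t0T wneg; have := rate_diag_le0 a0 => q0.
    by rewrite oppr_le0 mulr_ge0//; [apply: le_trans t_leT|lra].
  have := supersolution_lower_bound sw (ltW m0) _ (w0 a) t_ge0.
  move=> /(_ (fun s b => _)) H.
  apply: le_trans (H _); last first.
    move=> s b /andP[s0 st]; apply: infS; rewrite s0/=; exact: le_trans t_leT.
  rewrite ler_wnM2l ?(ltW m0)// lerD2l lerN2 ler_expR.
  have qK := Kw _ _ tT wn; have q0 := rate_diag_le0 a.
  rewrite -lerN2 opprK -mulrN; apply: ler_pM => //; lra.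
have e0 := expR_gt0 (- (T * K)).
rewrite mulrBr mulr1 gerBl => ?.
have := nmulr_rlt0 (expR (- (T * K))) m0; rewrite e0 => ?; lra.
Qed.

(** The last condition bounds the jump rates on each sublevel set of F. *)
Record lyapunov (F : E -> R) (c : R) : Prop := Lyapunov {
  lyapunov_ge1 : forall a, 1 <= F a;
  lyapunov_gen : forall a, gen F a <= c * F a;
  lyapunov_rate : forall a, - Q a a <= c * F a }.

Variables (F : E -> R) (c : R).
Hypothesis LF : lyapunov F c.

(** For eps > 0 the function w + eps e^{ct} F is a supersolution which can only
be negative on a sublevel set of F, where the jump rates are bounded; apply
[supersolution_ge0] and let eps vary. *)
Lemma comparison w T M : supersolution w ->
  (forall t a, 0 <= t <= T -> - M <= w t a) -> (forall a, 0 <= w 0 a) ->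
  forall t a, 0 <= t <= T -> 0 <= w t a.
Proof.
move=> sw Mw w0 t a tT.
have F1 := lyapunov_ge1 LF.
have c0 : 0 <= c.
  have := le_trans (_ : 0 <= - Q a a) (lyapunov_rate LF a).
  rewrite oppr_ge0 rate_diag_le0 => /(_ isT); rewrite pmulr_lge0//.
  exact: lt_le_trans (F1 a).
rewrite leNgt; apply/negP => wneg.
(* With this eps the perturbed function would still be negative at (t, a). *)
pose eps := - w t a / (2 * (expR (t * c) * F a)).
have eF0 : 0 < expR (t * c) * F a.
  by rewrite mulr_gt0 ?expR_gt0//; exact: lt_le_trans (F1 a).
have eps0 : 0 < eps by rewrite divr_gt0 ?oppr_gt0// mulr_gt0.
have := @supersolution_ge0 _ T M (c * (M / eps))
  (supersolution_add sw (supersolution_exp (ltW eps0) (lyapunov_gen LF))).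
move=> /(_ _ _ _ t a tT) H.
suff : 0 <= w t a + eps * (expR (t * c) * F a).
  by rewrite /eps -mulrA invfM -[_^-1 * _ * _]mulrA mulVf ?gt_eqF// mulr1; lra.
have W (s : R) b : 0 <= s -> F b <= expR (s * c) * F b.
  move=> s0; rewrite ler_peMl//; first exact: le_trans (F1 b).
  by rewrite -expR0 ler_expR mulr_ge0.
apply: H.
- move=> s b sT; have /andP[s0 _] := sT.
  apply: (le_trans (Mw s b sT)); rewrite lerDl mulr_ge0 ?(ltW eps0)//.
  by apply: le_trans (W s b s0); exact: le_trans (F1 b).
- move=> s b sT; have /andP[s0 _] := sT => neg.
  apply: (le_trans (lyapunov_rate LF b)); rewrite ler_wpM2l//.
  rewrite ler_pdivlMr// mulrC.
  have := ler_wpM2l (ltW eps0) (W s b s0); have := Mw s b sT; lra.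
- move=> b; rewrite addr_ge0// mulr_ge0 ?(ltW eps0)// mulr_ge0 ?expR_ge0//.
  exact: le_trans (F1 b).
Qed.

Lemma backward_unique w1 w2 T M : backward w1 -> backward w2 ->
  (forall t a, 0 <= t <= T -> `|w1 t a| <= M) ->
  (forall t a, 0 <= t <= T -> `|w2 t a| <= M) ->
  (forall a, w1 0 a = w2 0 a) ->
  forall t a, 0 <= t <= T -> w1 t a = w2 t a.
Proof.
have half v1 v2 : backward v1 -> backward v2 ->
    (forall t a, 0 <= t <= T -> `|v1 t a| <= M) ->
    (forall t a, 0 <= t <= T -> `|v2 t a| <= M) ->
    (forall a, v1 0 a = v2 0 a) ->
    forall t a, 0 <= t <= T -> v2 t a <= v1 t a.
  move=> b1 b2 M1 M2 v0 t a tT; rewrite -subr_ge0 -mulN1r.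
  apply: (@comparison (fun t a => v1 t a + -1 * v2 t a) T (M + M)) tT.
  - apply/backward_supersolution/backward_add => //; exact: backward_cmul.
  - move=> s b sT; have := M1 s b sT; have := M2 s b sT.
    by rewrite !ler_norml => /andP[] ? ? /andP[] ? ?; lra.
  - by move=> b; rewrite v0; lra.
move=> b1 b2 M1 M2 v0 t a tT; apply/eqP; rewrite eq_le.
by rewrite (half w1 w2)// (half w2 w1).
Qed.

Lemma sum_solution_le1 (r : seq E) t a : uniq r -> 0 <= t ->
  \sum_(b <- r) solution b t a <= 1.
Proof.
move=> ur t0; rewrite -subr_ge0 -mulN1r.
apply: (@comparison (fun t a => 1 + -1 * \sum_(b <- r) solution b t a) t
  (size r)%:R); last by rewrite t0 lexx.
- apply/backward_supersolution/backward_add; first exact: backward_cst.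
  by apply/backward_cmul/backward_bigsum => // b; exact: solution_backward.
- move=> s b /andP[s0 _]; have : \sum_(x <- r) solution x s b <= (size r)%:R.
    rewrite -sum1_size natr_sum; apply: ler_sum => x _; exact: solution_le1.
  by lra.
- move=> b; under eq_bigr do rewrite solution0//.
  rewrite -natr_sum -big_mkcond sum1_count.
  rewrite (eq_count (a2 := pred1 b)); last by move=> x /=; rewrite eq_sym.
  by rewrite count_uniq_mem//; case: (_ \in _) => /=; lra.
Qed.

(** Outside r one has F > K, hence 1 - e^{ct} F / K starts below the indicator
function of r; it is a subsolution because constants are annihilated by Q. *)
Lemma sum_solution_ge (r : seq E) K t a : uniq r -> 0 <= t -> 0 < K ->
  (forall b, F b <= K -> b \in r) ->
  1 - expR (t * c) * F a / K <= \sum_(b <- r) solution b t a.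
Proof.
move=> ur t0 K0 Kr; rewrite -subr_ge0.
have -> : \sum_(b <- r) solution b t a - (1 - expR (t * c) * F a / K) =
  \sum_(b <- r) solution b t a + -1 + K^-1 * (expR (t * c) * F a) by ring.
have F1 := lyapunov_ge1 LF.
have term0 s b : 0 <= K^-1 * (expR (s * c) * F b).
  rewrite mulr_ge0 ?invr_ge0 ?(ltW K0)// mulr_ge0 ?expR_ge0//.
  exact: le_trans (F1 b).
apply: (@comparison (fun t a => \sum_(b <- r) solution b t a + -1 +
   K^-1 * (expR (t * c) * F a)) t 1); last by rewrite t0 lexx.
- apply: supersolution_add.
    apply/backward_supersolution/backward_add; last exact: backward_cst.
    by apply: backward_bigsum => // b; exact: solution_backward.
  by apply: supersolution_exp; [rewrite invr_ge0 ltW|exact: lyapunov_gen LF].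
- move=> s b /andP[s0 _]; have : 0 <= \sum_(x <- r) solution x s b.
    by apply: sumr_ge0 => x _; exact: solution_ge0.
  by have := term0 s b; lra.
- move=> b; under eq_bigr do rewrite solution0//.
  rewrite -natr_sum -big_mkcond sum1_count.
  rewrite (eq_count (a2 := pred1 b)); last by move=> x /=; rewrite eq_sym.
  rewrite count_uniq_mem//.
  have [br|br] := boolP (b \in r) => /=; first by have := term0 0 b; lra.
  rewrite mul0r expR0 mul1r add0r addrC subr_ge0 ler_pdivlMl// mulr1.
  by rewrite leNgt; apply: contra br => /ltW /Kr.
Qed.

Lemma regular_lyapunov : (forall K, finite_set [set a | F a <= K]) -> regular Q.
Proof.
move=> Ffin; split; first exact: row_finite_rate_matrix Qrf.
move=> t t0 a.
under eq_esum do rewrite (minimal_solutionE Qrf)//.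
have sum_set (A : set E) : finite_set A -> exists2 r : seq E, uniq r &
    A = [set` r].
  move=> /finite_seqP[r ->]; exists (undup r); first exact: undup_uniq.
  by apply/seteqP; split => x /=; rewrite mem_undup.
apply/eqP; rewrite eq_le; apply/andP; split.
  apply: ge_ereal_sup => _ [A [finA _] <-].
  have [r ur ->] := sum_set A finA.
  by rewrite -fsbig_seq//= sumEFin lee_fin sum_solution_le1.
apply/lee_addgt0Pr => e e0.
pose K := expR (t * c) * F a / e.
have K0 : 0 < K.
  rewrite divr_gt0// mulr_gt0 ?expR_gt0//.
  exact: lt_le_trans (lyapunov_ge1 LF a).
have [r ur rK] := sum_set _ (Ffin K).
have Kr b : F b <= K -> b \in r by move=> FK; have : [set` r] b by rewrite -rK.
have := sum_solution_ge (t := t) a ur t0 K0 Kr.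
rewrite /K invf_div mulrCA divff ?mulr1; last first.
  rewrite gt_eqF// mulr_gt0 ?expR_gt0//.
  exact: lt_le_trans (lyapunov_ge1 LF a).
rewrite -lee_fin EFinB leeBlDr// => /le_trans; apply.
rewrite leeD2r//; apply: esum_ge; exists [set` r].
  by split => //; exact: finite_seq.
by rewrite -fsbig_seq//= sumEFin.
Qed.

(** Applying Q to the indicator of b gives the column of b, so the indicator plus
K t is a supersolution and the indicator minus K t a subsolution. *)
Lemma solution_near_start b K : (forall a, `|Q a b| <= K) ->
  forall t a, 0 <= t -> `|solution b t a - (a == b)%:R| <= K * t.
Proof.
move=> QK t a t0.
have K0 : 0 <= K by exact: le_trans (QK b).
have super x : `|x| <= 1 ->
    supersolution (fun t a => t * K + x * (a == b)%:R + - x * solution b t a).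
  move=> x1; apply: supersolution_add; last first.
    exact/backward_supersolution/backward_cmul/solution_backward.
  move=> a'; split.
    move=> s; apply: cvgD; last exact: cvg_cst.
    by apply: cvgM; [exact: cvg_id|exact: cvg_cst].
  move=> s s0; exists K.
    have := is_derive_add (is_derive_mul (@is_derive_id _ _ s 1)
      (is_derive_const K s)) (is_derive_const (x * (a' == b)%:R) s).
    by rewrite mul1r mulr0 !addr0.
  rewrite gen_add (gen_cst Qrf) add0r gen_cmul gen_indicator.
  rewrite (le_trans (ler_norm _))// normrM (le_trans _ (QK a'))//.
  by rewrite ler_piMl.
have side x : `|x| <= 1 ->
    0 <= t * K + x * (a == b)%:R + - x * solution b t a.
  move=> x1; apply: (comparison (super x x1) (M := 2)) (_ : 0 <= t <= t).
  - move=> s a' /andP[s0 _].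
    have := solution_ge0 Qrf b a' s0; have := solution_le1 Qrf b a' s0.
    have := mulr_ge0 s0 K0; move: x1; rewrite ler_norml => /andP[? ?].
    set y := solution _ _ _ => *.
    have : `|x * ((a' == b)%:R - y)| <= 1.
      rewrite normrM mulr_ile1//; first by rewrite ler_norml; apply/andP.
      by rewrite ler_norml; case: (a' == b) => /=; apply/andP; split; lra.
    by rewrite ler_norml => /andP[]; lra.
  - by move=> a'; rewrite solution0// mul0r; lra.
  - by rewrite t0 lexx.
rewrite ler_norml mulrC; apply/andP; split.
- by have := side (-1); rewrite normrN normr1 lexx => /(_ isT); lra.
- by have := side 1; rewrite normr1 lexx => /(_ isT); lra.
Qed.

(** A time shift of a solution is a solution; by comparison, the difference of
the two is at all times bounded by its initial bound [solution_near_start]. *)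
Lemma solution_lipschitz b K : (forall a, `|Q a b| <= K) ->
  forall s t a, 0 <= s -> 0 <= t ->
  `|solution b s a - solution b t a| <= K * `|s - t|.
Proof.
move=> QK s t a.
wlog st : s t / s <= t.
  move=> W s0 t0; have [st|ts] := leP s t; first exact: W.
  by rewrite distrC [X in _ * X]distrC; apply: W => //; exact: ltW.
move=> s0 t0; set h := t - s; have h0 : 0 <= h by rewrite subr_ge0.
have side x : `|x| <= 1 -> 0 <= K * h +
    (x * solution b (s + h) a + - x * solution b s a).
  move=> x1; apply: (@comparison (fun r a => K * h +
     (x * solution b (r + h) a + - x * solution b r a)) s 2).
  - apply/backward_supersolution/backward_add; first exact: backward_cst.
    apply: backward_add; last exact/backward_cmul/solution_backward.
    apply: (@backward_cmul _ _ _ _ _ (fun r a => solution b (r + h) a)).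
    by apply: backward_shift => //; exact: solution_backward.
  - move=> r a' /andP[r0 _].
    have := solution_ge0 Qrf b a' r0; have := solution_le1 Qrf b a' r0.
    have rh0 := addr_ge0 r0 h0.
    have := solution_ge0 Qrf b a' rh0; have := solution_le1 Qrf b a' rh0.
    have : 0 <= K * h by rewrite mulr_ge0// (le_trans _ (QK b)).
    set y := solution _ _ _; set z := solution _ _ _ => *.
    have : `|x * (y - z)| <= 1.
      by rewrite normrM mulr_ile1// ler_norml; apply/andP; split; lra.
    by rewrite ler_norml => /andP[]; lra.
  - move=> a'; rewrite add0r solution0//.
    have := solution_near_start QK a' h0; set z := solution _ _ _ - _ => zK.
    have : `|x * z| <= K * h.
      by rewrite normrM (le_trans _ zK)// ler_piMl.
    by rewrite ler_norml => /andP[]; rewrite /z; lra.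
  - by rewrite s0 lexx.
have sh : s + h = t by rewrite /h addrC subrK.
have -> : `|s - t| = h by rewrite distrC ger0_norm.
rewrite ler_norml; apply/andP; split.
- by have := side (-1); rewrite normrN normr1 lexx sh => /(_ isT); lra.
- by have := side 1; rewrite normr1 lexx sh => /(_ isT); lra.
Qed.

(** The right-hand side is a supersolution that starts above the indicator of b. *)
Lemma solution_decay b (G : E -> R) k : (forall a, 0 <= G a) -> 0 < G b ->
  (forall a, gen G a <= k * G a) ->
  forall t a, 0 <= t -> solution b t a <= expR (t * k) * G a / G b.
Proof.
move=> G0 Gb Gk t a t0; rewrite -subr_ge0.
have -> : expR (t * k) * G a / G b - solution b t a =
  (G b)^-1 * (expR (t * k) * G a) + -1 * solution b t a by ring.
have term0 s a' : 0 <= (G b)^-1 * (expR (s * k) * G a').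
  by rewrite mulr_ge0 ?invr_ge0 ?G0// mulr_ge0 ?expR_ge0.
apply: (@comparison (fun t a => (G b)^-1 * (expR (t * k) * G a) +
   -1 * solution b t a) t 1); last by rewrite t0 lexx.
- apply: supersolution_add; first by apply: supersolution_exp; rewrite ?invr_ge0.
  exact/backward_supersolution/backward_cmul/solution_backward.
- move=> s a' /andP[s0 _]; have := term0 s a'.
  by have := solution_le1 Qrf b a' s0; lra.
- move=> a'; rewrite solution0// mul0r expR0 mul1r.
  have := term0 0 a'; rewrite mul0r expR0 mul1r.
  by have [->|_] := eqVneq a' b => /=; [rewrite mulVf ?gt_eqF//; lra|lra].
Qed.

End Comparison.

(** * The Feller property *)

Section Feller.
Context {R : realType} {E : countType} (Q : E -> E -> R) (nb : E -> seq E).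
Hypothesis Qrf : row_finite Q nb.
Notation solution := (solution Q nb).
Hypothesis solution_sum : forall (r : seq E) (t : R) (a : E), uniq r -> 0 <= t ->
  \sum_(b <- r) solution b t a <= 1.

(** The part of the series outside r is at most eps, as the total mass is at most
1. The bound is uniform in a and t, so both halves of the Feller property
reduce to statements on single entries of the semigroup. *)
Lemma semigroup_apply_approx (f : E -> R) (eps : R) (r : seq E) t a :
  uniq r -> 0 <= eps -> (forall b, b \notin r -> `|f b| <= eps) -> 0 <= t ->
  `|semigroup_apply (markov_semigroup Q) t f a -
    \sum_(b <- r) solution b t a * f b| <= eps.
Proof.
move=> ur eps0 fr t0.
set P := markov_semigroup Q.
have P0 b : 0 <= P t a b by rewrite /P (markov_semigroupE Qrf)// (solution_ge0 Qrf).
have off_r (h : E -> R) : (forall b, 0 <= h b) ->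
    (forall b, b \notin r -> h b <= eps) -> exists2 y,
    (\esum_(b in [set: E]) (P t a b * h b)%:E =
      (\sum_(b <- r) P t a b * h b + y)%:E)%E & 0 <= y <= eps.
  move=> h0 hr.
  have Ph b : (0 <= (P t a b * h b)%:E)%E by rewrite lee_fin mulr_ge0.
  rewrite (esumID [set` r])// !setTI.
  have -> : (\esum_(b in [set` r]) (P t a b * h b)%:E =
      (\sum_(b <- r) P t a b * h b)%:E)%E.
    by apply: esum_seq => // [b br /negP|b _]; [rewrite br|rewrite -lee_fin].
  set z := (\esum_(_ in ~` _) _)%E.
  have z0 : (0 <= z)%E by apply: esum_ge0.
  have ze : (z <= eps%:E)%E.
    apply: ge_ereal_sup => _ [B [/finite_seqP[s ->] sr] <-].
    have -> : [set` s] = [set` undup s].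
      by apply/seteqP; split => x /=; rewrite mem_undup.
    rewrite -fsbig_seq ?undup_uniq//= sumEFin lee_fin.
    apply: (@le_trans _ _ (eps * \sum_(b <- undup s) P t a b)).
      rewrite big_distrr /= [leLHS]big_seq [leRHS]big_seq; apply: ler_sum => b.
      by rewrite mem_undup => /sr /negP br; rewrite mulrC ler_wpM2r// hr.
    rewrite ler_piMr//; under eq_bigr do rewrite /P (markov_semigroupE Qrf)//.
    exact: solution_sum (undup_uniq s) t0.
  have zfin : z \is a fin_num by rewrite ge0_fin_numE// (le_lt_trans ze)// ltry.
  exists (fine z); first by rewrite EFinD fineK.
  by rewrite -!lee_fin fineK// z0.
have [|b br|y1 E1 /andP[y10 y1e]] := off_r (fun b => Num.max (f b) 0).
- by move=> b; rewrite le_max lexx orbT.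
- by rewrite ge_max eps0 andbT (le_trans (ler_norm _))// fr.
have [|b br|y2 E2 /andP[y20 y2e]] := off_r (fun b => Num.max (- f b) 0).
- by move=> b; rewrite le_max lexx orbT.
- by rewrite ge_max eps0 andbT (le_trans (ler_norm _))// normrN fr.
rewrite /semigroup_apply.
rewrite [X in (X - _)%E](_ : _ =
    (\sum_(b <- r) P t a b * Num.max (f b) 0 + y1)%:E); last first.
  rewrite -E1; apply: eq_esum => b _.
  by rewrite funeposE -EFin_max maxr_pMr// mulr0.
rewrite [X in (_ - X)%E](_ : _ =
    (\sum_(b <- r) P t a b * Num.max (- f b) 0 + y2)%:E); last first.
  rewrite -E2; apply: eq_esum => b _.
  by rewrite funenegE -EFinN -EFin_max maxr_pMr// mulr0 mulrN.
rewrite -EFinB /=.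
have -> : \sum_(b <- r) solution b t a * f b =
   \sum_(b <- r) P t a b * Num.max (f b) 0 -
   \sum_(b <- r) P t a b * Num.max (- f b) 0.
  rewrite -sumrB; apply: eq_bigr => b _; rewrite /P (markov_semigroupE Qrf)//.
  rewrite -mulrBr; congr (_ * _).
  by have [fb|fb] := leP (f b) 0; have [|] := leP (- f b) 0; lra.
set S1 := \sum_(_ <- _) _; set S2 := \sum_(_ <- _) _.
by rewrite ler_norml; apply/andP; split; lra.
Qed.

Hypothesis lipschitz : forall b, exists K : R, forall (s t : R) (a : E),
  0 <= s -> 0 <= t ->
  `|solution b s a - solution b t a| <= K * `|s - t|.
Hypothesis decay : forall b (t eps : R), 0 <= t -> 0 < eps ->
  finite_set [set a | eps <= `|solution b t a|].

Let C0_seq (f : E -> R) (eps : R) : C0 f -> 0 < eps -> exists2 r : seq E, uniq r &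
  forall b, b \notin r -> `|f b| <= eps.
Proof.
move=> f0 e0; have /finite_seqP[s sE] := f0 _ e0.
exists (undup s); first exact: undup_uniq.
move=> b; rewrite mem_undup => /negP bs; apply/ltW; rewrite ltNge; apply/negP.
by move=> fb; apply: bs; have : [set` s] b by rewrite -sE.
Qed.

(** A state is required because the supremum over an empty set is -oo. *)
Lemma feller_of_solution (a0 : E) : feller (markov_semigroup Q).
Proof.
split=> [t t0 f f0 eps e0|f f0 t t0].
  have e20 : 0 < eps / 2 by rewrite divr_gt0.
  have [r ur fr] := C0_seq f0 e20.
  pose d := eps / 2 / (1 + \sum_(b <- r) `|f b|).
  have S0 : 0 < 1 + \sum_(b <- r) `|f b|.
    by rewrite ltr_pwDl// sumr_ge0.
  have d0 : 0 < d by rewrite divr_gt0.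
  apply: (@sub_finite_set _ _
    (\bigcup_(b in [set` r]) [set a | d <= `|solution b t a|])); last first.
    by apply: bigcup_finite; [exact: finite_seq|move=> b _; exact: decay].
  move=> a /=; rewrite leNgt => /negP; apply: contra_notP => small.
  have /= ap := semigroup_apply_approx a ur (ltW e20) fr t0.
  have : `|\sum_(b <- r) solution b t a * f b| < eps / 2.
    apply: (@le_lt_trans _ _ (d * \sum_(b <- r) `|f b|)).
      rewrite (le_trans (ler_norm_sum _ _ _))// big_distrr /=.
      rewrite [leLHS]big_seq [leRHS]big_seq; apply: ler_sum => b br.
      rewrite normrM ler_wpM2r// ltW// ltNge; apply/negP => db.
      by apply: small; exists b.
    rewrite /d mulrAC ltr_pdivrMr// ltr_pM2l// ltrDr//.
  move: ap; set x := semigroup_apply _ _ _ _; set y := \sum_(_ <- _) _.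
  by rewrite ler_norml !ltr_norml => /andP[? ?] /andP[? ?]; apply/andP; split; lra.
have [K KP] := choice lipschitz.
have K0 b : 0 <= K b.
  have := le_trans (normr_ge0 _) (KP b 1 0 a0 ler01 (lexx _)).
  by rewrite subr0 normr1 mulr1.
have small (eps : R) : 0 < eps -> \forall s \near within `[0, +oo[ (nbhs t),
    (0 <= sup_norm (semigroup_apply (markov_semigroup Q) s f \-
      semigroup_apply (markov_semigroup Q) t f)%R <= eps%:E)%E.
  move=> e0; have e30 : 0 < eps / 3 by rewrite divr_gt0.
  have [r ur fr] := C0_seq f0 e30.
  pose L := 1 + \sum_(b <- r) K b * `|f b|.
  have L0 : 0 < L.
    by rewrite ltr_pwDl// sumr_ge0// => b _; rewrite mulr_ge0.
  have d0 : 0 < eps / 3 / L by rewrite divr_gt0.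
  rewrite near_withinE; near=> s => /=; rewrite in_itv/= andbT => s0.
  have st : `|s - t| <= eps / 3 / L.
    rewrite distrC; near: s.
    by apply: (@cvgr_dist_le _ _ _ (nbhs t) _ id t); [exact: cvg_id|].
  apply/andP; split.
    apply: (@le_trans _ _ `|(semigroup_apply (markov_semigroup Q) s f a0 -
        semigroup_apply (markov_semigroup Q) t f a0)|%:E).
      by rewrite lee_fin.
    by apply: ereal_sup_ubound; exists a0.
  apply: ge_ereal_sup => _ [a _ <-]; rewrite lee_fin /=.
  have := semigroup_apply_approx a ur (ltW e30) fr s0.
  have := semigroup_apply_approx a ur (ltW e30) fr t0.
  have : `|\sum_(b <- r) solution b s a * f b -
           \sum_(b <- r) solution b t a * f b| <= eps / 3.
    rewrite -sumrB (le_trans (ler_norm_sum _ _ _))//.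
    apply: (@le_trans _ _ (`|s - t| * L)); last by rewrite -ler_pdivlMr.
    apply: (@le_trans _ _ (`|s - t| * \sum_(b <- r) K b * `|f b|)); last first.
      by rewrite ler_wpM2l// lerDr.
    rewrite big_distrr /=; apply: ler_sum => b _.
    rewrite -mulrBl normrM mulrA ler_wpM2r// [leRHS]mulrC.
    exact: KP.
  set A1 := semigroup_apply _ _ _ _; set A2 := semigroup_apply _ _ _ _.
  set B1 := \sum_(_ <- _) _; set B2 := \sum_(_ <- _) _.
  rewrite !ler_norml => /andP[? ?] /andP[? ?] /andP[? ?].
  by apply/andP; split; lra.
have F : Filter (within `[0, +oo[ (nbhs t)) by exact: within_filter.
apply: cvg_EFin.
  apply: filterS (small 1 ltr01) => s /andP[s0 s1].
  by rewrite ge0_fin_numE// (le_lt_trans s1)// ltry.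
apply/cvgrPdist_le => eps e0; apply: filterS (small eps e0) => s /andP[s0 s1].
rewrite /= sub0r normrN ger0_norm ?fine_ge0//.
by rewrite -lee_fin fineK// ge0_fin_numE// (le_lt_trans s1)// ltry.
Unshelve. all: by end_near. Qed.

End Feller.

(** * The birth-death chain on the integers *)

Section BilateralChain.
Context {R : realType} (u u' v v' : complex R).
Hypothesis hu : forall k : int, 0 < (u + k%:~R) * (u' + k%:~R).
Hypothesis hv : forall k : int, 0 < (v + k%:~R) * (v' + k%:~R).

Let a := complex.Re (u + u').
Let b := complex.Re (u * u').
Let a' := complex.Re (v + v').
Let b' := complex.Re (v * v').

Lemma complexIntr (x : int) : x%:~R = Complex x%:~R 0 :> complex R.
Proof. by rewrite -(rmorph_int (@real_complex R)). Qed.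

(** The real part is linear over the reals, so the rates are monic quadratic
polynomials with real coefficients. *)
Lemma rate_upE (x : int) :
  rate_up u u' x = x%:~R ^+ 2 - complex.Re (u + u') * x%:~R + complex.Re (u * u').
Proof.
rewrite /rate_up complexIntr; case: u => ? ?; case: u' => ? ? /=; ring.
Qed.

Lemma rate_downE (x : int) : rate_down v v' x =
  x%:~R ^+ 2 + complex.Re (v + v') * x%:~R + complex.Re (v * v').
Proof.
rewrite /rate_down complexIntr; case: v => ? ?; case: v' => ? ? /=; ring.
Qed.

Lemma rate_up_gt0 (x : int) : 0 < rate_up u u' x.
Proof.
have := hu (- x); rewrite ltcE => /andP[_].
congr (_ < complex.Re _); rewrite mulrNz; ring.
Qed.

Lemma rate_down_gt0 (x : int) : 0 < rate_down v v' x.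
Proof.
have := hv x; rewrite ltcE => /andP[_].
congr (_ < complex.Re _); ring.
Qed.

Definition nbz (x : int) : seq int := [:: x + 1; x - 1].

Lemma calD_up x : calD u u' v v' x (x + 1) = rate_up u u' x.
Proof. by rewrite /calD eqxx. Qed.

Lemma calD_down x : calD u u' v v' x (x - 1) = rate_down v v' x.
Proof. by rewrite /calD eqxx; case: eqP => // ?; lia. Qed.

Lemma calD_diag x : calD u u' v v' x x = - rate_up u u' x - rate_down v v' x.
Proof.
by rewrite /calD eqxx; case: eqP => [?|_]; [lia|case: eqP => [?|//]; lia].
Qed.

Lemma calD_off x y : y != x -> y \notin nbz x -> calD u u' v v' x y = 0.
Proof.
by rewrite /calD !inE negb_or => /negbTE -> /andP[/negbTE -> /negbTE ->].
Qed.

Lemma calD_row_finite : row_finite (calD u u' v v') nbz.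
Proof.
split=> [x|x||x y xy|x].
- by rewrite /= inE andbT; apply/eqP => ?; lia.
- by rewrite !inE negb_or; apply/andP; split; apply/eqP => ?; lia.
- exact: calD_off.
- have [] := boolP (y \in nbz x).
    rewrite !inE => /orP[] /eqP ->.
      by rewrite calD_up ltW// rate_up_gt0.
    by rewrite calD_down ltW// rate_down_gt0.
  by move=> yn; rewrite calD_off// eq_sym.
- by rewrite 2!big_cons big_nil calD_up calD_down calD_diag addr0 opprD.
Qed.

Lemma gen_calD (f : int -> R) x : gen (calD u u' v v') nbz f x =
  rate_up u u' x * (f (x + 1) - f x) + rate_down v v' x * (f (x - 1) - f x).
Proof.
rewrite /gen /inflow 2!big_cons big_nil calD_up calD_down calD_diag; ring.
Qed.

Definition rate_bound : R := `|a| + `|b| + `|a'| + `|b'|.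

Let abound : `|a| <= rate_bound /\ `|b| <= rate_bound /\
  `|a'| <= rate_bound /\ `|b'| <= rate_bound.
Proof.
rewrite /rate_bound; have := normr_ge0 a; have := normr_ge0 b.
have := normr_ge0 a'; have := normr_ge0 b'; lra.
Qed.

Lemma normr_le_sqr (X : R) : `|X| <= 1 + X ^+ 2.
Proof.
have := sqr_ge0 (`|X| - 1); rewrite sqrrB real_normK ?num_real//.
by have := normr_ge0 X; lra.
Qed.

Lemma rate_total_le (x : int) : rate_up u u' x + rate_down v v' x <=
  (4 * rate_bound + 2) * (1 + x%:~R ^+ 2).
Proof.
rewrite rate_upE rate_downE -/a -/b -/a' -/b'; set X := x%:~R.
have [A [B [A' B']]] := abound; set M := rate_bound in A B A' B' *.
have X1 := normr_le_sqr X.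
have M0 : 0 <= M by exact: le_trans (normr_ge0 a) A.
have H1 : (a' - a) * X <= (2 * M) * (1 + X ^+ 2).
  rewrite (le_trans (ler_norm _))// normrM ler_pM// (le_trans (ler_normB _ _))//.
  by lra.
have := ler_norm b; have := ler_norm b'.
have : 0 <= M * X ^+ 2 by rewrite mulr_ge0 ?sqr_ge0.
lra.
Qed.

(** The quadratic parts of the two rates agree, so the drift is affine in x and
the operator raises the degree of no polynomial. *)
Lemma gen_square (x : int) :
  gen (calD u u' v v') nbz (fun y => 1 + y%:~R ^+ 2) x <=
  (10 * rate_bound + 2) * (1 + x%:~R ^+ 2).
Proof.
rewrite gen_calD rate_upE rate_downE -/a -/b -/a' -/b' !(rmorphD, rmorphN) /=.
set X := x%:~R.
have [A [B [A' B']]] := abound; set M := rate_bound in A B A' B' *.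
have X1 := normr_le_sqr X.
have M0 : 0 <= M by exact: le_trans (normr_ge0 a) A.
have H1 : (a' - a + 2 * (b - b')) * X <= (6 * M) * (1 + X ^+ 2).
  rewrite (le_trans (ler_norm _))// normrM ler_pM//.
  rewrite (le_trans (ler_normD _ _))// (le_trans (lerD (ler_normB _ _) (lexx _)))//.
  rewrite normrM (ger0_norm (_ : 0 <= 2 :> R))//.
  by have := ler_normB b b'; lra.
have H2 : - (a + a') * X ^+ 2 <= 2 * M * X ^+ 2.
  rewrite ler_wpM2r ?sqr_ge0// (le_trans (ler_norm _))// normrN.
  by rewrite (le_trans (ler_normD _ _))//; lra.
have := ler_norm b; have := ler_norm b'.
have -> : (X ^+ 2 - a * X + b) * (1 + (X + 1) ^+ 2 - (1 + X ^+ 2)) +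
  (X ^+ 2 + a' * X + b') * (1 + (X - 1) ^+ 2 - (1 + X ^+ 2)) =
  2 * (- (a + a') * X ^+ 2) + (a' - a + 2 * (b - b')) * X + 2 * X ^+ 2 + b + b'.
  by ring.
have : 0 <= M * X ^+ 2 by rewrite mulr_ge0 ?sqr_ge0.
lra.
Qed.

Lemma calD_lyapunov : lyapunov (calD u u' v v') nbz
  (fun x => 1 + x%:~R ^+ 2) (10 * rate_bound + 2).
Proof.
have M0 : 0 <= rate_bound by have [A _] := abound; exact: le_trans (normr_ge0 a) A.
split=> x; first by rewrite lerDl sqr_ge0.
  exact: gen_square.
rewrite calD_diag opprD !opprK (le_trans (rate_total_le x))//.
by rewrite ler_wpM2r ?addr_ge0 ?sqr_ge0//; lra.
Qed.

(** For rates equal to x^2 the two differences combine to x^2 (6 x^2 - 4) over the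
product (1 + (x+1)^2) (1 + (x-1)^2) = x^4 + 4, times 1 / (1 + x^2). The affine
remainders of the rates, multiplied by 2x + 1 or 2x - 1, are dominated by
1 + (x+1)^2 and 1 + (x-1)^2 respectively. *)
Lemma gen_inv_square (x : int) :
  gen (calD u u' v v') nbz (fun y => (1 + y%:~R ^+ 2)^-1) x <=
  (24 * rate_bound + 6) * (1 + x%:~R ^+ 2)^-1.
Proof.
rewrite gen_calD rate_upE rate_downE -/a -/b -/a' -/b' !(rmorphD, rmorphN) /=.
set X := x%:~R.
have [A [B [A' B']]] := abound; set M := rate_bound in A B A' B' *.
have M0 : 0 <= M by exact: le_trans (normr_ge0 a) A.
have D0 : 0 < 1 + X ^+ 2 by rewrite ltr_pwDl ?sqr_ge0.
have D1 : 0 < 1 + (X + 1) ^+ 2 by rewrite ltr_pwDl ?sqr_ge0.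
have D2 : 0 < 1 + (X - 1) ^+ 2 by rewrite ltr_pwDl ?sqr_ge0.
have X2 := sqr_ge0 (`|X| - 1).
have XX : `|X| ^+ 2 = X ^+ 2 by rewrite real_normK ?num_real.
have aff p q : `|p| <= M -> `|q| <= M -> `|p * X + q| <= M * (1 + `|X|).
  move=> pM qM; rewrite (le_trans (ler_normD _ _))// normrM.
  by have := ler_wpM2r (normr_ge0 X) pM; lra.
have odd s : `|s| = 1 -> `|2 * X + s| <= 2 * `|X| + 1.
  by move=> s1; rewrite (le_trans (ler_normD _ _))// normrM s1 ger0_norm.
have up : (b - a * X) * - (2 * X + 1) <= 12 * M * (1 + (X + 1) ^+ 2).
  rewrite mulrN (le_trans (ler_norm _))// normrN normrM.
  apply: (@le_trans _ _ (M * (1 + `|X|) * (2 * `|X| + 1))).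
    apply: ler_pM => //; last by apply: odd; rewrite normr1.
    by rewrite addrC -mulNr; apply: aff => //; rewrite normrN.
  rewrite -mulrA [12 * M]mulrC -mulrA ler_wpM2l//.
  have := sqr_ge0 (2 * X + 3); have := ler_norm X; have := ler_norm (- X).
  by rewrite normrN; nra.
have down : (b' + a' * X) * (2 * X - 1) <= 12 * M * (1 + (X - 1) ^+ 2).
  rewrite (le_trans (ler_norm _))// normrM.
  apply: (@le_trans _ _ (M * (1 + `|X|) * (2 * `|X| + 1))).
    apply: ler_pM => //; last by apply: odd; rewrite normrN normr1.
    by rewrite addrC; apply: aff.
  rewrite -mulrA [12 * M]mulrC -mulrA ler_wpM2l//.
  have := sqr_ge0 (2 * X - 3); have := ler_norm X; have := ler_norm (- X).
  by rewrite normrN; nra.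
rewrite -subr_ge0.
have -> : (24 * M + 6) * (1 + X ^+ 2)^-1 -
  ((X ^+ 2 - a * X + b) * ((1 + (X + 1) ^+ 2)^-1 - (1 + X ^+ 2)^-1) +
   (X ^+ 2 + a' * X + b') * ((1 + (X - 1) ^+ 2)^-1 - (1 + X ^+ 2)^-1)) =
  (((24 * M + 6) * (1 + (X + 1) ^+ 2) * (1 + (X - 1) ^+ 2)
   - X ^+ 2 * (6 * X ^+ 2 - 4)
   - (b - a * X) * - (2 * X + 1) * (1 + (X - 1) ^+ 2)
   - (b' + a' * X) * (2 * X - 1) * (1 + (X + 1) ^+ 2))
  / ((1 + X ^+ 2) * (1 + (X + 1) ^+ 2) * (1 + (X - 1) ^+ 2))).
  by field; rewrite !gt_eqF.
rewrite divr_ge0//; last by rewrite ltW// !mulr_gt0.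
have := ler_wpM2r (ltW D2) up; have := ler_wpM2r (ltW D1) down.
set U := _ * _ * (1 + (X - 1) ^+ 2); set W := _ * _ * (1 + (X + 1) ^+ 2).
have -> : (24 * M + 6) * (1 + (X + 1) ^+ 2) * (1 + (X - 1) ^+ 2) =
  12 * M * (1 + (X + 1) ^+ 2) * (1 + (X - 1) ^+ 2) +
  12 * M * (1 + (X - 1) ^+ 2) * (1 + (X + 1) ^+ 2) + 6 * (X ^+ 2 * X ^+ 2) + 24.
  by ring.
by have := sqr_ge0 X; rewrite /U /W; lra.
Qed.

End BilateralChain.

(** * Determinants with a replaced row or column *)

Section DeterminantRowsColumns.
Context {R : comPzRingType} {n : nat}.
Implicit Types A B : 'M[R]_n.

Definition row_repl A B k : 'M[R]_n :=
  \matrix_(i, j) if i == k then B i j else A i j.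

Definition col_repl A B k : 'M[R]_n :=
  \matrix_(i, j) if j == k then B i j else A i j.

Lemma cofactor_agree A B i j : (forall i' j', i' != i -> A i' j' = B i' j') ->
  cofactor A i j = cofactor B i j.
Proof.
move=> AB; rewrite /cofactor; congr (_ * \det _); apply/matrixP => i' j'.
by rewrite !mxE AB// eq_sym neq_lift.
Qed.

Lemma det_row_repl A B k : \det (row_repl A B k) = \sum_j B k j * cofactor A k j.
Proof.
rewrite (expand_det_row _ k); apply: eq_bigr => j _; rewrite mxE eqxx.
congr (_ * _); apply: cofactor_agree => i' j' /negbTE i'k.
by rewrite mxE i'k.
Qed.

Lemma col_repl_tr A B k : col_repl A B k = (row_repl A^T B^T k)^T.
Proof. by apply/matrixP => i j; rewrite !mxE. Qed.

Lemma det_col_repl A B k : \det (col_repl A B k) = \sum_i B i k * cofactor A i k.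
Proof.
rewrite col_repl_tr det_tr det_row_repl; apply: eq_bigr => i _.
by rewrite cofactor_tr !mxE.
Qed.

(** Both sides are the sum of the entries of B against the cofactors of A. When B
arises from A by an operator applied to each entry, this trades an operator
acting on one variable at a time for the same operator acting on one column
at a time. *)
Lemma sum_det_row_repl A B :
  \sum_k \det (row_repl A B k) = \sum_k \det (col_repl A B k).
Proof.
under eq_bigr do rewrite det_row_repl.
under [RHS]eq_bigr do rewrite det_col_repl.
exact: exchange_big.
Qed.

Lemma det_col_eq A j k : j != k -> (forall i, A i j = A i k) -> \det A = 0.
Proof.
move=> jk Ajk; rewrite -det_tr; apply: (determinant_alternate jk) => i.
by rewrite !mxE.
Qed.

End DeterminantRowsColumns.

(** * Generalized Vandermonde determinants *)

Section PowerDeterminants.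
Context {R : comNzRingType} {n : nat} (x : 'I_n -> R).
Implicit Types e : 'I_n -> nat.

Definition pow_mx e : 'M[R]_n := \matrix_(i, j) x i ^+ e j.

Definition pow_det e : R := \det (pow_mx e).

Definition set_exp e (j : 'I_n) m : 'I_n -> nat :=
  fun j' => if j' == j then m else e j'.

Lemma pow_det_repeat e j k : j != k -> e j = e k -> pow_det e = 0.
Proof.
by move=> jk ejk; apply: (det_col_eq jk) => i; rewrite !mxE ejk.
Qed.

Lemma det_col_repl_horner e j (q : {poly R}) m : (size q <= m)%N ->
  \det (col_repl (pow_mx e) (\matrix_(i, j) q.[x i]) j) =
  \sum_(l < m) q`_l * pow_det (set_exp e j l).
Proof.
move=> qm; rewrite det_col_repl.
transitivity (\sum_(l < m) q`_l * \sum_i x i ^+ l * cofactor (pow_mx e) i j).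
  under eq_bigr do rewrite mxE (horner_coef_wide _ qm) mulr_suml.
  rewrite exchange_big /=; apply: eq_bigr => l _; rewrite mulr_sumr.
  by apply: eq_bigr => i _; rewrite -mulrA.
apply: eq_bigr => l _; congr (_ * _); rewrite /pow_det.
have -> : pow_mx (set_exp e j l) =
    col_repl (pow_mx e) (\matrix_(i, j) x i ^+ l) j.
  by apply/matrixP => i k; rewrite !mxE /set_exp; case: eqP.
by rewrite det_col_repl; apply: eq_bigr => i _; rewrite mxE.
Qed.

(** Multiplication by a power sum acts on one variable at a time; moved to the
columns, it raises one exponent at a time. *)
Lemma power_sum_pow_det e m : (\sum_i x i ^+ m) * pow_det e =
  \sum_j pow_det (set_exp e j (e j + m)).
Proof.
transitivity (\sum_j \det (col_repl (pow_mx e)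
    (\matrix_(i, j) (x i ^+ m * x i ^+ e j)) j)).
  rewrite -sum_det_row_repl mulr_suml; apply: eq_bigr => k _.
  rewrite det_row_repl /pow_det (expand_det_row _ k) mulr_sumr.
  by apply: eq_bigr => j _; rewrite !mxE mulrA.
apply: eq_bigr => j _; congr (\det _); apply/matrixP => i k; rewrite !mxE.
by rewrite /set_exp; case: eqP => // ->; rewrite -exprD addnC.
Qed.

Lemma pow_det_swap e j k : j != k -> pow_det (e \o tperm j k) = - pow_det e.
Proof.
move=> jk; rewrite /pow_det.
have -> : pow_mx (e \o tperm j k) = col_perm (tperm j k) (pow_mx e).
  by apply/matrixP => i l; rewrite !mxE.
by rewrite col_permE det_mulmx det_perm tpermV odd_tperm jk mulrN1.
Qed.

End PowerDeterminants.

Section VandermondeExpansion.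
Context {R : comNzRingType} {n : nat} (x : 'I_n.+2 -> R).

Let id_exp : 'I_n.+2 -> nat := @nat_of_ord n.+2.
Let last2 : 'I_n.+2 := ord_max.
Let last1 : 'I_n.+2 := inord n.

Definition vdm : R := pow_det x id_exp.
(** Together with [vdm2] and [vdm11] below, these are the Vandermonde determinant
times the Schur functions of (1), (2) and minus that of (1, 1): the only new
determinants that appear when one exponent is raised by at most 2. *)
Definition vdm1 : R := pow_det x (set_exp id_exp last2 n.+2).
Definition vdm2 : R := pow_det x (set_exp id_exp last2 n.+3).
Definition vdm11 : R := pow_det x (set_exp id_exp last1 n.+2).

Let last1E : last1 = n :> nat. Proof. by rewrite inordK. Qed.

Let set_exp_small j m : (m < n.+2)%N ->
  pow_det x (set_exp id_exp j m) = if m == j then vdm else 0.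
Proof.
move=> mn; case: eqP => [->|/eqP mj].
  congr pow_det; apply/funext => k; rewrite /set_exp; case: eqP => // ->.
  by [].
apply: (@pow_det_repeat _ _ _ _ j (Ordinal mn)).
  by apply: contraNneq mj => ->.
by rewrite /set_exp eqxx; case: eqP.
Qed.

Lemma det_col_repl_vdm (q : {poly R}) (j : 'I_n.+2) : (size q <= j.+3)%N ->
  \det (col_repl (pow_mx x id_exp) (\matrix_(i, j) q.[x i]) j) =
  q`_j * vdm + (if j == last2 then q`_n.+2 * vdm1 + q`_n.+3 * vdm2
                else if j == last1 then q`_n.+2 * vdm11 else 0).
Proof.
move=> qj.
have qn : (size q <= n.+4)%N by apply: leq_trans qj _; rewrite !ltnS leq_ord.
rewrite (det_col_repl_horner _ _ _ qn) big_ord_recr big_ord_recr /= -addrA.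
congr (_ + _).
  rewrite (bigD1 j)//= set_exp_small// eqxx big1 ?addr0// => l lj.
  by rewrite set_exp_small// (negbTE (_ : val l != j)) ?mulr0.
have [->|j2] := eqVneq j last2; first by [].
have jn : (j <= n)%N.
  by rewrite -ltnS ltn_neqAle -ltnS ltn_ord andbT.
have q3 : q`_n.+3 = 0 by rewrite nth_default// (leq_trans qj).
have [->|j1] := eqVneq j last1; first by rewrite q3 mul0r addr0.
have j1' : (j < n)%N.
  rewrite ltn_neqAle jn andbT; apply: contraNneq j1 => jn'.
  by apply/eqP/val_inj; rewrite /= last1E.
by rewrite q3 nth_default ?mul0r ?addr0// (leq_trans qj).
Qed.

(** A power already present in another column contributes nothing, and degree at
most j + 2 leaves room for a new power only in the last two columns. *)
Lemma sum_det_col_repl_vdm (q : 'I_n.+2 -> {poly R}) :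
  (forall j : 'I_n.+2, (size (q j) <= j.+3)%N) ->
  \sum_j \det (col_repl (pow_mx x id_exp) (\matrix_(i, j) (q j).[x i]) j) =
  (\sum_j (q j)`_j) * vdm + (q last2)`_n.+2 * vdm1 + (q last2)`_n.+3 * vdm2 +
  (q last1)`_n.+2 * vdm11.
Proof.
move=> qs.
have l12 : last1 != last2 by rewrite -val_eqE /= last1E neq_ltn ltnSn.
transitivity (\sum_j ((q j)`_j * vdm +
   (if j == last2 then (q j)`_n.+2 * vdm1 + (q j)`_n.+3 * vdm2
                else if j == last1 then (q j)`_n.+2 * vdm11 else 0))).
  apply: eq_bigr => j _; rewrite -det_col_repl_vdm//; congr (\det _).
  by apply/matrixP => i k; rewrite !mxE; case: eqP => // ->.
rewrite big_split /= -mulr_suml -!addrA; congr (_ + _).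
rewrite (bigD1 last2)//= eqxx addrA; congr (_ + _).
rewrite (bigD1 last1)//= eqxx (negbTE l12) big1 ?addr0// => j /andP[j2 j1].
by rewrite (negbTE j2) (negbTE j1).
Qed.

Let last12 : last1 != last2.
Proof. by rewrite -val_eqE /= last1E neq_ltn ltnSn. Qed.

Let small_or_last (j : 'I_n.+2) : [\/ j = last2, j = last1 | (j < n)%N].
Proof.
have [jn|] := ltnP j n; first by constructor 3.
rewrite leq_eqVlt => /predU1P[nj|nj].
  by constructor 2; apply/val_inj; rewrite /= last1E.
by constructor 1; apply/val_inj/eqP; rewrite eqn_leq nj -ltnS ltn_ord.
Qed.

Let sum_last2 (F : 'I_n.+2 -> R) : (forall j : 'I_n.+2, (j < n)%N -> F j = 0) ->
  \sum_j F j = F last2 + F last1.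
Proof.
move=> F0; rewrite (bigD1 last2)//= (bigD1 last1)//= big1 ?addr0// => j.
by case/andP; have [->|->|/F0//] := small_or_last j; rewrite eqxx.
Qed.

Lemma power_sum1_vdm : (\sum_i x i ^+ 1) * vdm = vdm1.
Proof.
rewrite power_sum_pow_det sum_last2; last first.
  by move=> j jn; rewrite set_exp_small addn1 ?ltnS ?(ltnW jn)// gtn_eqF.
rewrite [X in _ + X](_ : _ = 0); last first.
  by rewrite /id_exp last1E addn1 set_exp_small ?last1E// gtn_eqF.
rewrite addr0 /id_exp addn1.
by [].
Qed.

Lemma power_sum2_vdm : (\sum_i x i ^+ 2) * vdm = vdm2 + vdm11.
Proof.
rewrite power_sum_pow_det sum_last2; last first.
  move=> j jn; rewrite set_exp_small addn2 ?ltnS ?jn//.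
  by rewrite gtn_eqF// ltnS leqnSn.
by rewrite /id_exp /= last1E !addn2.
Qed.

Lemma power_sum1_vdm1 : (\sum_i x i ^+ 1) * vdm1 = vdm2 - vdm11.
Proof.
rewrite power_sum_pow_det sum_last2.
  congr (_ + _).
    congr pow_det; apply/funext => k; rewrite /set_exp eqxx addn1.
    by case: eqP.
  rewrite -(pow_det_swap _ _ last12); congr pow_det; apply/funext => k.
  rewrite /set_exp /= (negbTE last12) /id_exp last1E addn1.
  have l21 : (last2 == last1) = false by rewrite eq_sym (negbTE last12).
  case: tpermP => [->|->|/eqP k1 /eqP k2].
  - by rewrite eqxx l21.
  - by rewrite l21 !eqxx.
  - by rewrite (negbTE k1) (negbTE k2).
move=> j jn; have jS : (j.+1 < n.+2)%N by rewrite ltnS (leq_trans jn).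
apply: (@pow_det_repeat _ _ _ _ j (Ordinal jS)).
  by rewrite -val_eqE /= ltn_eqF.
have j2 (k : 'I_n.+2) : (k <= n)%N -> k == last2 = false.
  by move=> kn; rewrite -val_eqE /= ltn_eqF.
rewrite /set_exp eqxx j2 ?(ltnW jn)// addn1 -val_eqE /= gtn_eqF//.
by rewrite j2.
Qed.

End VandermondeExpansion.

(** * The birth-death operator on powers *)

Section PolynomialAction.
Context {R : realType} (u u' v v' : complex R).
Notation genz := (gen (calD u u' v v') nbz).

Let s : R := complex.Re (u + u' + v + v').

Let sE : s = complex.Re (u + u') + complex.Re (v + v').
Proof. by rewrite /s -addrA raddfD. Qed.

(** Besides D consider E p = up p(x+1) - down p(x-1) and T p = up p(x+1) +
down p(x-1). They satisfy D (x p) = x D p + E p, E (x p) = x E p + T p and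
T (x p) = x T p + E p, which yields degrees and leading coefficients by
induction on the exponent. *)
Lemma gen_pow_poly m : exists p : {poly R},
  [/\ forall x : int, genz (fun y => y%:~R ^+ m) x = p.[x%:~R],
      (size p <= m.+1)%N & p`_m = m%:R * (m%:R - 1) - s * m%:R].
Proof.
(* The polynomials p, e and t represent D, E and T on x^m. *)
suff [p [e [t [[pE eE tE] [ps es ts] [pm em tm]]]]] :
  exists p e t : {poly R},
  [/\ [/\ forall x : int, genz (fun y => y%:~R ^+ m) x = p.[x%:~R],
        forall x : int, rate_up u u' x * (x + 1)%:~R ^+ m -
          rate_down v v' x * (x - 1)%:~R ^+ m = e.[x%:~R]
      & forall x : int, rate_up u u' x * (x + 1)%:~R ^+ m +
          rate_down v v' x * (x - 1)%:~R ^+ m = t.[x%:~R]],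
      [/\ forall j, (m < j)%N -> p`_j = 0, forall j, (m.+1 < j)%N -> e`_j = 0
      & forall j, (m.+2 < j)%N -> t`_j = 0]
    & [/\ p`_m = m%:R * (m%:R - 1) - s * m%:R, e`_m.+1 = 2 * m%:R - s
      & t`_m.+2 = 2]].
  by exists p; split => //; apply/leq_sizeP.
elim: m => [|m [p [e [t [[pE eE tE] [ps es ts] [pm em tm]]]]]].
  pose U : {poly R} := 'X^2 - complex.Re (u + u') *: 'X + (complex.Re (u * u'))%:P.
  pose W : {poly R} := 'X^2 + complex.Re (v + v') *: 'X + (complex.Re (v * v'))%:P.
  have UE x : rate_up u u' x = U.[x%:~R] by rewrite rate_upE /U !hornerE.
  have WE x : rate_down v v' x = W.[x%:~R] by rewrite rate_downE /W !hornerE.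
  exists 0, (U - W), (U + W); split; split.
  - by move=> x; rewrite gen_calD !expr0 !subrr !mulr0 addr0 hornerE.
  - by move=> x; rewrite !expr0 !mulr1 UE WE !hornerE.
  - by move=> x; rewrite !expr0 !mulr1 UE WE !hornerE.
  - by move=> j _; rewrite coef0.
  - move=> [|[|[|j]]]// _; rewrite /U /W !coefE /= ?mulr0; lra.
  - move=> [|[|[|j]]]// _; rewrite /U /W !coefE /= ?mulr0; lra.
  - by rewrite coef0 mul0r mulr0 subrr.
  - by rewrite sE /U /W !coefE /=; lra.
  - by rewrite /U /W !coefE /= ?mulr0; lra.
exists ('X * p + e), ('X * e + t), ('X * t + e); split; split.
- move=> x; rewrite !hornerE -pE -eE !gen_calD !exprS intrD intrB; ring.
- move=> x; rewrite !hornerE -eE -tE !exprS intrD intrB; ring.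
- move=> x; rewrite !hornerE -eE -tE !exprS intrD intrB; ring.
- by move=> [|j] jm //; rewrite coefD coefXM/= ps ?es ?addr0//; lia.
- by move=> [|j] jm //; rewrite coefD coefXM/= es ?ts ?addr0//; lia.
- by move=> [|j] jm //; rewrite coefD coefXM/= ts ?es ?addr0//; lia.
- by rewrite coefD coefXM/= pm em -natr1; ring.
- by rewrite coefD coefXM/= em tm -natr1; ring.
- by rewrite coefD coefXM/= tm es ?addr0// ltnS.
Qed.

Lemma dconstE n : dconst u u' v v' n =
  \sum_(j < n) (j%:R * (j%:R - 1) - s * j%:R).
Proof.
elim: n => [|n IHn]; first by rewrite big_ord0 /dconst !mul0r mulr0 subrr.
by rewrite big_ord_recr /= -IHn /dconst -/s -natr1; field.
Qed.

(** D is triangular on the powers of x, so replacing a column x^j by its image only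
multiplies the determinant by the diagonal coefficient; these add up to d_N. *)
Lemma gen_vdm_cofactor n (x : 'I_n.+2 -> int) :
  \sum_(k < n.+2) \sum_(j < n.+2) genz (fun y => y%:~R ^+ j) (x k) *
    cofactor (pow_mx (fun i => (x i)%:~R) (@nat_of_ord _)) k j =
  dconst u u' v v' n.+2 * vdm (fun i => (x i)%:~R : R).
Proof.
have [p pP] := choice gen_pow_poly.
pose q (j : 'I_n.+2) := p j.
have qs (j : 'I_n.+2) : (size (q j) <= j.+3)%N.
  by have [_ ps _] := pP j; apply: leq_trans ps _; lia.
have := sum_det_col_repl_vdm (fun i => (x i)%:~R) qs.
rewrite -sum_det_row_repl.
have -> : (q ord_max)`_n.+2 = 0.
  by have [_ ps _] := pP n.+1; rewrite nth_default.
have -> : (q ord_max)`_n.+3 = 0.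
  by have [_ ps _] := pP n.+1; rewrite nth_default// (leq_trans ps).
have -> : (q (inord n))`_n.+2 = 0.
  have [_ ps _] := pP n; rewrite nth_default// /q inordK//.
  by rewrite (leq_trans ps).
rewrite !mul0r !addr0 dconstE => E; rewrite -[RHS]/(_ * _).
have -> : \sum_(j < n.+2) (j%:R * (j%:R - 1) - s * j%:R) = \sum_j (q j)`_j.
  by apply: eq_bigr => j _; have [_ _ ->] := pP j.
rewrite -E; apply: eq_bigr => k _; rewrite det_row_repl; apply: eq_bigr => j _.
by rewrite mxE; have [-> _ _] := pP j.
Qed.

(** The commutator of D with multiplication by x^2 raises the degree by at most 2,
which is the case covered by [sum_det_col_repl_vdm]. *)
Lemma gen_square_vdm_cofactor n : exists c : R * R * R * R,
  forall x : 'I_n.+2 -> int,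
  \sum_(k < n.+2) \sum_(j < n.+2) (genz (fun y => y%:~R ^+ j.+2) (x k) -
     (x k)%:~R ^+ 2 * genz (fun y => y%:~R ^+ j) (x k)) *
    cofactor (pow_mx (fun i => (x i)%:~R) (@nat_of_ord _)) k j =
  c.1.1.1 * vdm (fun i => (x i)%:~R) + c.1.1.2 * vdm1 (fun i => (x i)%:~R) +
  c.1.2 * vdm2 (fun i => (x i)%:~R) + c.2 * vdm11 (fun i => (x i)%:~R).
Proof.
have [p pP] := choice gen_pow_poly.
pose q (j : 'I_n.+2) := p j.+2 - 'X^2 * p j.
have qs (j : 'I_n.+2) : (size (q j) <= j.+3)%N.
  apply/leq_sizeP => i ji; rewrite /q coefB coefXnM.
  have [_ /leq_sizeP ps _] := pP j.+2; have [_ /leq_sizeP ps' _] := pP j.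
  by rewrite ps// ps' ?if_same ?subr0//; lia.
exists (\sum_j (q j)`_j, (q ord_max)`_n.+2, (q ord_max)`_n.+3,
  (q (inord n))`_n.+2) => x /=.
rewrite -sum_det_col_repl_vdm// -sum_det_row_repl.
apply: eq_bigr => k _; rewrite det_row_repl; apply: eq_bigr => j _.
rewrite mxE /q !hornerE; have [-> _ _] := pP j.+2; have [-> _ _] := pP j.
by [].
Qed.

End PolynomialAction.

(** * Moves of signatures *)

Section SignatureMoves.
Context {N : nat}.
Implicit Types (lam mu : signature N) (x : 'I_N -> int).

Lemma shifted_lt lam (i j : 'I_N) : (i < j)%N -> shifted lam j < shifted lam i.
Proof.
move=> ij; have ltr_ : transitive (>=%R : rel int).
  by move=> ? ? ? /= h1 h2; exact: le_trans h2 h1.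
have rfl : reflexive (>=%R : rel int) by move=> ?; exact: lexx.
have := sorted_leq_nth ltr_ rfl 0 (valP lam).
move=> /(_ i j); rewrite !inE size_tuple !ltn_ord => /(_ isT isT (ltnW ij)).
by rewrite -!tnth_nth /shifted => ?; lia.
Qed.

Lemma shifted_injective lam : injective (shifted lam).
Proof.
move=> i j ij.
by case: (ltngtP i j) => [/(shifted_lt lam)|/(shifted_lt lam)|/ord_inj//];
  rewrite ij ltxx.
Qed.

Lemma shifted_ext lam mu : shifted lam =1 shifted mu -> lam = mu.
Proof.
move=> lm; apply/val_inj/eq_from_tnth => i; have := lm i.
by rewrite /shifted => ?; lia.
Qed.

Definition set_coord x (k : 'I_N) (y : int) : 'I_N -> int :=
  fun i => if i == k then y else x i.

Definition move lam (k : 'I_N) (s : int) : N.-tuple int :=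
  [tuple tnth (val lam) i + (if i == k then s else 0) | i < N].

Lemma move_shifted lam k s mu : val mu = move lam k s ->
  shifted mu = set_coord (shifted lam) k (shifted lam k + s).
Proof.
move=> mus; apply/funext => i; rewrite /shifted mus tnth_mktuple /set_coord.
by case: eqP => [->|_]; lia.
Qed.

(** Two neighbouring coordinates l_i can only leave their strict order under a
unit step by becoming equal. *)
Lemma move_sorted lam k s : s \in [:: 1; -1 : int] ->
  injective (set_coord (shifted lam) k (shifted lam k + s)) ->
  sorted >=%R (move lam k s : seq int).
Proof.
move=> s1 inj; apply/(sortedP 0) => i; rewrite size_tuple => iN.
have iN' := ltnW iN.
have E (j : 'I_N) : nth 0 (move lam k s) j = tnth (move lam k s) j.
  by rewrite (tnth_nth 0).
rewrite (E (Ordinal iN)) (E (Ordinal iN')).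
change (is_true (tnth (move lam k s) (Ordinal iN) <=
  tnth (move lam k s) (Ordinal iN'))).
rewrite leNgt; apply/negP => lt.
have := @inj (Ordinal iN) (Ordinal iN').
suff -> : set_coord (shifted lam) k (shifted lam k + s) (Ordinal iN) =
     set_coord (shifted lam) k (shifted lam k + s) (Ordinal iN').
  by move=> /(_ erefl)/(congr1 val)/= /eqP; rewrite gtn_eqF.
have := @shifted_lt lam (Ordinal iN') (Ordinal iN) (ltnSn _).
move: lt; rewrite !tnth_mktuple /set_coord /shifted /=.
move: s1; rewrite !inE => /orP[] /eqP -> {inj}.
  case: eqP => [<-|_]; case: eqP => [<-|_] /=; lia.
case: eqP => [<-|_]; case: eqP => [<-|_] /=; lia.
Qed.

Definition nbsig lam : seq (signature N) :=
  pmap insub [seq move lam k s | k <- enum 'I_N, s <- [:: 1; -1]].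

Lemma mem_nbsig lam mu : reflect (exists k s, s \in [:: 1; -1 : int] /\
    shifted mu = set_coord (shifted lam) k (shifted lam k + s)) (mu \in nbsig lam).
Proof.
rewrite /nbsig mem_pmap_sub; apply: (iffP allpairsP).
  move=> [[k s] /= [_ s1 mus]]; exists k, s; split => //.
  exact: move_shifted.
move=> [k [s [s1 mus]]]; exists (k, s); rewrite /= mem_enum; split => //.
apply: eq_from_tnth => i; have := congr1 (fun f => f i) mus.
rewrite /set_coord tnth_mktuple /shifted /=; case: eqP => [->|_] ?; lia.
Qed.

Lemma nbsig_uniq lam : uniq (nbsig lam).
Proof.
apply: pmap_sub_uniq; apply: allpairs_uniq; [exact: enum_uniq|by []|].
move=> p q /allpairsP[[k s] [_ s1 ->]] /allpairsP[[k' s'] [_ _ ->]] /= kk.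
have s0 : s != 0 by move: s1; rewrite !inE => /orP[] /eqP /= ->.
have := congr1 (fun t => tnth t k) kk; rewrite !tnth_mktuple eqxx.
case: eqP => [<- /addrI -> //|_ /addrI s00].
by rewrite s00 eqxx in s0.
Qed.

Lemma nbsig_irrefl lam : lam \notin nbsig lam.
Proof.
apply/mem_nbsig => -[k [s [s1 /(congr1 (fun f => f k))]]].
rewrite /set_coord eqxx; move: s1; rewrite !inE => /orP[] /eqP ->; lia.
Qed.

Definition alternating (R : realType) (Phi : ('I_N -> int) -> R) :=
  forall x i j, i != j -> x i = x j -> Phi x = 0.

End SignatureMoves.

(** * The rates on signatures as a transform by the dimension *)

Section SignatureChain.
Context {R : realType} (u u' v v' : complex R) {N : nat}.
Hypothesis hu : forall k : int, 0 < (u + k%:~R) * (u' + k%:~R).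
Hypothesis hv : forall k : int, 0 < (v + k%:~R) * (v' + k%:~R).
Implicit Types (lam mu : signature N).
Notation rates := (calD u u' v v').
Notation dN := (dconst u u' v v' N).
Notation DN := (@calDN R u u' v v' N).

Definition fact_prod : R := \prod_(1 <= i < N) (i`!)%:R.

Lemma fact_prod_gt0 : 0 < fact_prod.
Proof. by apply: prodr_gt0 => i _; rewrite ltr0n fact_gt0. Qed.

Lemma DimE lam : Dim R lam = (\prod_(i < N) \prod_(j < N | (i < j)%N)
   ((shifted lam i)%:~R - (shifted lam j)%:~R)) / fact_prod.
Proof.
congr (_ / _); apply: eq_bigr => i _; apply: eq_bigr => j _.
by rewrite -intrB; congr (_%:~R); rewrite /shifted; lia.
Qed.

Lemma Dim_ge lam : fact_prod^-1 <= Dim R lam.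
Proof.
rewrite DimE ler_peMl ?invr_ge0 ?(ltW fact_prod_gt0)//.
have ge1M (x y : R) : 1 <= x -> 1 <= y -> 1 <= x * y by exact: mulr_ege1.
apply: (big_ind (fun z : R => 1 <= z)) => // i _.
apply: (big_ind (fun z : R => 1 <= z)) => // j ij.
rewrite -intrB -[1]/(1%:~R) ler_int; have := shifted_lt lam ij; lia.
Qed.

Lemma Dim_gt0 lam : 0 < Dim R lam.
Proof. by apply: lt_le_trans (Dim_ge lam); rewrite invr_gt0 fact_prod_gt0. Qed.

(** The sign accounts for the factors l_i - l_j of the dimension, opposite to those
of the Vandermonde determinant. *)
Definition vdm_coef : R :=
  (\prod_(i < N) \prod_(j < N | (i < j)%N) (-1)) / fact_prod.

Lemma Dim_pow_det lam : Dim R lam =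
  vdm_coef * pow_det (fun i => (shifted lam i)%:~R) (@nat_of_ord N).
Proof.
pose a : 'rV[R]_N := \row_i (shifted lam i)%:~R.
have -> : pow_det (fun i => (shifted lam i)%:~R) (@nat_of_ord N) =
    \det (Vandermonde N a).
  by rewrite -det_tr; congr (\det _); apply/matrixP => i j; rewrite !mxE.
rewrite det_Vandermonde DimE /vdm_coef mulrAC -big_split /=; congr (_ / _).
apply: eq_bigr => i _; rewrite -big_split /=; apply: eq_bigr => j _.
by rewrite !mxE mulN1r opprB.
Qed.

(** The sum over k of D acting on the k-th coordinate, without the constraint that
the coordinates be decreasing. *)
Definition coord_gen (Phi : ('I_N -> int) -> R) (x : 'I_N -> int) : R :=
  \sum_k gen rates nbz (fun y => Phi (set_coord x k y)) (x k).

Lemma set_coord_id (x : 'I_N -> int) k : set_coord x k (x k) = x.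
Proof. by apply/funext => i; rewrite /set_coord; case: eqP => // ->. Qed.

Lemma DN_diag lam : DN lam lam =
  \sum_k rates (shifted lam k) (shifted lam k) - dN.
Proof.
rewrite /calDN eqxx divff ?gt_eqF ?Dim_gt0// mul1r mulr1; congr (_ - _).
apply: eq_bigr => k _; rewrite (_ : [forall i, _]) ?mulr1//.
by apply/forallP => i; rewrite eqxx implybT.
Qed.

Lemma DN_move lam mu k s : s \in [:: 1; -1 : int] ->
  shifted mu = set_coord (shifted lam) k (shifted lam k + s) ->
  DN lam mu = Dim R mu / Dim R lam * rates (shifted lam k) (shifted lam k + s).
Proof.
move=> s1 mus.
have s0 : s != 0 by move: s1; rewrite !inE => /orP[] /eqP ->.
have lm : (lam == mu) = false.
  apply/eqP => lm; have := congr1 (fun f => f k) mus.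
  rewrite lm /set_coord eqxx => /eqP; rewrite addrC -subr_eq subrr eq_sym.
  by rewrite (negbTE s0).
rewrite /calDN lm mulr0 subr0; congr (_ * _); rewrite (bigD1 k)//=.
rewrite big1 ?addr0 => [|k' k'k]; last first.
  rewrite (_ : [forall i, _] = false) ?mulr0//; apply/negbTE/negP => /forallP.
  move=> /(_ k); rewrite eq_sym k'k mus /set_coord eqxx /= => /eqP.
  by move=> /eqP; rewrite addrC -subr_eq subrr eq_sym (negbTE s0).
rewrite (_ : [forall i, _]) ?mulr1; last first.
  apply/forallP => i; apply/implyP => ik.
  by rewrite mus /set_coord (negbTE ik).
by rewrite mus /set_coord eqxx.
Qed.

(** A unit step that leaves the set of signatures makes two coordinates equal, and
there an alternating function vanishes. Hence the sum over signatures equals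
the unconstrained sum, and D^(N) is the transform of the independent motion of
N particles by the dimension. *)
Lemma Dim_gen (Phi : ('I_N -> int) -> R) (h : signature N -> R) lam :
  alternating Phi -> (forall mu, Dim R mu * h mu = Phi (shifted mu)) ->
  Dim R lam * gen DN nbsig h lam =
  coord_gen Phi (shifted lam) - dN * Phi (shifted lam).
Proof.
move=> alt hPhi; rewrite /gen mulrDr DN_diag mulrCA [Dim _ _ * h _]hPhi.
rewrite mulrBl addrAC; congr (_ - _).
rewrite /inflow /nbsig big_pmap big_allpairs_dep /= /coord_gen.
rewrite big_enum /= mulr_suml mulr_sumr -big_split /=.
apply: eq_bigr => k _; rewrite /gen set_coord_id; congr (_ + _).
have step s : s \in [:: 1; -1 : int] -> Dim R lam *
    oapp (fun mu => DN lam mu * h mu) 0 (insub (move lam k s)) =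
    rates (shifted lam k) (shifted lam k + s) *
    Phi (set_coord (shifted lam) k (shifted lam k + s)).
  move=> s1; case: insubP => [mu _ mus|unsorted] /=.
    have E := move_shifted mus; rewrite (DN_move s1 E) -E -hPhi.
    by field; rewrite gt_eqF ?Dim_gt0.
  (* Outside the signatures the move produces two equal coordinates. *)
  have [inj|] := pselect (injective
      (set_coord (shifted lam) k (shifted lam k + s))).
    by rewrite (move_sorted s1 inj) in unsorted.
  move=> /existsNP[i /existsNP[j /not_implyP[ij /eqP ij']]].
  by rewrite (alt _ _ _ ij' ij) !mulr0.
rewrite /inflow 2!big_cons big_nil 2!big_cons big_nil !addr0 mulrDr.
by rewrite !step.
Qed.

End SignatureChain.

Section CoordinateGenerator.
Context {R : realType} (u u' v v' : complex R) {N : nat}.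
Hypothesis hu : forall k : int, 0 < (u + k%:~R) * (u' + k%:~R).
Hypothesis hv : forall k : int, 0 < (v + k%:~R) * (v' + k%:~R).
Notation rates := (calD u u' v v').
Notation genz := (gen rates nbz).
Let rf := calD_row_finite hu hv.

Definition fun_mx (phi : 'I_N -> int -> R) (x : 'I_N -> int) : 'M[R]_N :=
  \matrix_(i, j) phi j (x i).

Lemma det_fun_mx_set phi x k y : \det (fun_mx phi (set_coord x k y)) =
  \sum_j phi j y * cofactor (fun_mx phi x) k j.
Proof.
have -> : fun_mx phi (set_coord x k y) =
    row_repl (fun_mx phi x) (\matrix_(i, j) phi j y) k.
  by apply/matrixP => i j; rewrite !mxE /set_coord; case: eqP.
by rewrite det_row_repl; apply: eq_bigr => j _; rewrite mxE.
Qed.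

Lemma det_fun_mx_alternating phi :
  alternating (fun x => \det (fun_mx phi x)).
Proof.
move=> x i j ij xij; apply: (determinant_alternate ij) => k.
by rewrite !mxE xij.
Qed.

Lemma genz_comb (c : 'I_N -> R) (f : 'I_N -> int -> R) x :
  genz (fun y => \sum_j f j y * c j) x = \sum_j genz (f j) x * c j.
Proof.
rewrite (gen_bigsum rf); apply: eq_bigr => j _; rewrite mulrC -gen_cmul.
by congr gen; apply/funext => y; rewrite mulrC.
Qed.

(** A determinant is linear in the row of each variable. *)
Lemma coord_gen_det phi x :
  coord_gen u u' v v' (fun x => \det (fun_mx phi x)) x =
  \sum_k \sum_j genz (phi j) (x k) * cofactor (fun_mx phi x) k j.
Proof.
apply: eq_bigr => k _; rewrite -genz_comb; congr gen; apply/funext => y.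
exact: det_fun_mx_set.
Qed.

Lemma coord_gen_cmul (c : R) (Phi : ('I_N -> int) -> R) x :
  coord_gen u u' v v' (fun x => c * Phi x) x = c * coord_gen u u' v v' Phi x.
Proof.
by rewrite /coord_gen mulr_sumr; apply: eq_bigr => k _; rewrite gen_cmul.
Qed.

End CoordinateGenerator.

(** * Row sums and a Lyapunov function on signatures *)

Section SignatureRates.
Context {R : realType} (u u' v v' : complex R) {n : nat}.
Notation N := n.+2.
Hypothesis hu : forall k : int, 0 < (u + k%:~R) * (u' + k%:~R).
Hypothesis hv : forall k : int, 0 < (v + k%:~R) * (v' + k%:~R).
Implicit Types (lam mu : signature N).
Notation rates := (calD u u' v v').
Notation genz := (gen rates nbz).
Notation dN := (dconst u u' v v' N).
Notation DN := (@calDN R u u' v v' N).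
Let rf := calD_row_finite hu hv.

Notation kappa := (@vdm_coef R N).
Notation real_coords x := (fun i : 'I_N => (x i)%:~R : R).

Lemma vdm_fun_mx x : vdm (real_coords x) =
  \det (fun_mx (fun (j : 'I_N) y => y%:~R ^+ j) x).
Proof. by []. Qed.

Lemma vdm_alternating : alternating (fun x : 'I_N -> int => vdm (real_coords x)).
Proof. exact: (det_fun_mx_alternating (fun (j : 'I_N) y => y%:~R ^+ j)). Qed.

Lemma coord_gen_vdm x : coord_gen u u' v v' (fun x => vdm (real_coords x)) x =
  dN * vdm (real_coords x).
Proof. by rewrite -gen_vdm_cofactor -(coord_gen_det hu hv). Qed.

Lemma DN_off lam mu : mu != lam -> mu \notin nbsig lam -> DN lam mu = 0.
Proof.
move=> ml mn; rewrite /calDN eq_sym (negbTE ml) mulr0 subr0.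
rewrite big1 ?mulr0// => k _.
case: (boolP [forall i, _]) => [/forallP same|_]; last by rewrite mulr0.
have mus : shifted mu = set_coord (shifted lam) k (shifted mu k).
  apply/funext => i; rewrite /set_coord; case: eqP => [->//|/eqP ik].
  by have := same i; rewrite ik => /eqP.
rewrite mulr1 calD_off//.
  apply: contra ml => /eqP mk; apply/eqP/shifted_ext => i.
  by rewrite mus mk set_coord_id.
apply: contra mn; rewrite !inE => mk; apply/mem_nbsig.
by move: mk => /orP[] /eqP mk; exists k; [exists 1|exists (-1)];
  rewrite -mk !inE.
Qed.

Lemma DN_row_finite : row_finite DN nbsig.
Proof.
split=> [lam|lam||lam mu lm|lam].
- exact: nbsig_uniq.
- exact: nbsig_irrefl.
- exact: DN_off.
- have [/mem_nbsig[k [s [s1 mus]]]|mn] := boolP (mu \in nbsig lam).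
    rewrite (DN_move _ _ _ _ s1 mus) mulr_ge0//.
      by rewrite divr_ge0// ltW// Dim_gt0.
    apply: (rate_ge0 rf).
    by move: s1; rewrite !inE => /orP[] /eqP ->; apply/eqP; lia.
  by rewrite DN_off// eq_sym.
- have := @Dim_gen R u u' v v' N (fun x => kappa * vdm (real_coords x))
    (fun=> 1) lam.
  have E : coord_gen u u' v v' (fun x => kappa * vdm (real_coords x))
      (shifted lam) = kappa * (dN * vdm (real_coords (shifted lam))).
    by rewrite -coord_gen_vdm; exact: coord_gen_cmul.
  rewrite E [dN * (_ * _)]mulrCA subrr.
  have alt : alternating (fun x => kappa * vdm (real_coords x) : R).
    by move=> x i j ij xij; rewrite (vdm_alternating ij xij) mulr0.
  move=> /(_ alt (fun mu => _)) H.
  have /eqP : Dim R lam * gen DN nbsig (fun=> 1) lam = 0.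
    by apply: H => mu; rewrite mulr1 Dim_pow_det.
  rewrite mulf_eq0 gt_eqF ?Dim_gt0//= /gen /inflow /= mulr1.
  rewrite (eq_bigr (fun c => DN lam c)); last by move=> c _; rewrite mulr1.
  by rewrite addr_eq0 => /eqP.
Qed.

Definition sq_norm lam : R := \sum_k (shifted lam k)%:~R ^+ 2.

(** Pull 1 + p_2 out of the operator acting on the k-th variable: what remains is
the commutator of D with multiplication by the square of that variable. *)
Lemma coord_gen_vdm_square x : coord_gen u u' v v'
    (fun x => vdm (real_coords x) * (1 + \sum_i (x i)%:~R ^+ 2)) x =
  (1 + \sum_i (x i)%:~R ^+ 2) * (dN * vdm (real_coords x)) +
  \sum_(k < N) \sum_(j < N) (genz (fun y => y%:~R ^+ j.+2) (x k) -
     (x k)%:~R ^+ 2 * genz (fun y => y%:~R ^+ (j : nat)) (x k)) *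
    cofactor (pow_mx (real_coords x) (@nat_of_ord _)) k j.
Proof.
set P := 1 + _; rewrite -gen_vdm_cofactor mulr_sumr -big_split /=.
apply: eq_bigr => k _; rewrite mulr_sumr -big_split /=.
transitivity (genz (fun y => \sum_(j < N)
   ((P - (x k)%:~R ^+ 2) * y%:~R ^+ j + y%:~R ^+ j.+2) *
   cofactor (pow_mx (real_coords x) (@nat_of_ord _)) k j) (x k)).
  congr gen; apply/funext => y; rewrite vdm_fun_mx det_fun_mx_set mulr_suml.
  apply: eq_bigr => j _.
  have -> : 1 + \sum_i (set_coord x k y i)%:~R ^+ 2 =
      P - (x k)%:~R ^+ 2 + y%:~R ^+ 2 :> R.
    rewrite /P (bigD1 k)//= [in RHS](bigD1 k)//= /set_coord eqxx.
    rewrite (eq_bigr (fun i => (x i)%:~R ^+ 2)); last first.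
      by move=> i /negbTE ->.
    by ring.
  rewrite -[j.+2]addn2 exprD; set c := cofactor _ _ _.
  by ring.
rewrite (genz_comb hu hv); apply: eq_bigr => j _.
by rewrite gen_add gen_cmul; ring.
Qed.

(** D^(N) maps p_2 to a combination of 1, p_1, (p_2 + p_1^2) / 2 and
(p_2 - p_1^2) / 2 with constant coefficients, and p_1^2 <= N p_2. *)
Lemma DN_gen_square : exists c, forall lam,
  gen DN nbsig (fun mu => 1 + sq_norm mu) lam <= c * (1 + sq_norm lam).
Proof.
have [[[[c0 c1] c2] c3] cE] := @gen_square_vdm_cofactor R u u' v v' n.
exists ((`|c0| + `|c1| + `|c2| + `|c3|) * (1 + N%:R)) => lam.
pose X := real_coords (shifted lam).
pose p1 := \sum_i X i ^+ 1; pose p2 := sq_norm lam.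
have D0 := Dim_gt0 (R := R) lam.
have gE : gen DN nbsig (fun mu => 1 + sq_norm mu) lam =
    c0 + c1 * p1 + c2 * ((p2 + p1 ^+ 2) / 2) + c3 * ((p2 - p1 ^+ 2) / 2).
  apply: (mulfI (lt0r_neq0 D0)).
  rewrite (@Dim_gen R u u' v v' N (fun x => kappa *
    (vdm (real_coords x) * (1 + \sum_i (x i)%:~R ^+ 2)))); first last.
  - by move=> mu; rewrite mulrA Dim_pow_det.
  - by move=> x i j ij xij; rewrite (vdm_alternating ij xij) mul0r mulr0.
  have E : coord_gen u u' v v' (fun x => kappa *
      (vdm (real_coords x) * (1 + \sum_i (x i)%:~R ^+ 2))) (shifted lam) =
      kappa * coord_gen u u' v v' (fun x =>
        vdm (real_coords x) * (1 + \sum_i (x i)%:~R ^+ 2)) (shifted lam).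
    exact: coord_gen_cmul.
  rewrite E coord_gen_vdm_square cE Dim_pow_det -/(vdm X) -/X /=.
  have e1 : vdm1 X = p1 * vdm X by rewrite power_sum1_vdm.
  have e2 : vdm2 X + vdm11 X = p2 * vdm X by rewrite -power_sum2_vdm.
  have e3 : vdm2 X - vdm11 X = p1 ^+ 2 * vdm X.
    by rewrite -power_sum1_vdm1 e1 expr2 mulrA.
  have -> : vdm2 X = (p2 + p1 ^+ 2) / 2 * vdm X by lra.
  have -> : vdm11 X = (p2 - p1 ^+ 2) / 2 * vdm X by lra.
  by rewrite e1 -/(sq_norm lam) -/p2; ring.
have p20 : 0 <= p2 by apply: sumr_ge0 => i _; exact: sqr_ge0.
have p12 : p1 ^+ 2 <= N%:R * p2.
  have -> : N%:R * p2 = \sum_(i < N) \sum_(j < N) (X i ^+ 2 + X j ^+ 2) / 2.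
    under eq_bigr do rewrite -mulr_suml big_split /= sumr_const card_ord.
    rewrite -mulr_suml big_split /= sumr_const card_ord sumrMnl.
    have -> : \sum_(i < N) X i ^+ 2 = p2 by [].
    by rewrite -mulr_natl; field.
  rewrite expr2 mulr_suml; apply: ler_sum => i _; rewrite mulr_sumr.
  by apply: ler_sum => j _; have := sqr_ge0 (X i - X j); rewrite !expr1; nra.
rewrite gE; set S := N%:R in p12 *; have S0 : 0 <= S by rewrite ler0n.
have p1l := normr_le_sqr p1.
set P := (1 + S) * (1 + sq_norm lam).
have PE : P = 1 + S + p2 + S * p2 by rewrite /P -/p2; ring.
have Sp : 0 <= S * p2 by rewrite mulr_ge0.
have bnd c y : `|y| <= P -> c * y <= `|c| * P.
  by move=> yP; rewrite (le_trans (ler_norm _))// normrM ler_wpM2l.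
have p1sq := sqr_ge0 p1.
have b0 : c0 * 1 <= `|c0| * P by apply: bnd; rewrite normr1; lra.
have b1 : c1 * p1 <= `|c1| * P by apply: bnd; lra.
have b2 : c2 * ((p2 + p1 ^+ 2) / 2) <= `|c2| * P.
  by apply: bnd; rewrite ler_norml; apply/andP; split; lra.
have b3 : c3 * ((p2 - p1 ^+ 2) / 2) <= `|c3| * P.
  by apply: bnd; rewrite ler_norml; apply/andP; split; lra.
by rewrite -mulrA -/P; lra.
Qed.

Lemma DN_lyapunov :
  exists c, lyapunov DN nbsig (fun lam => 1 + sq_norm lam) c.
Proof.
have [c cP] := DN_gen_square.
pose M : R := 4 * rate_bound u u' v v' + 2.
have M0 : 0 <= M.
  rewrite addr_ge0// mulr_ge0// /rate_bound.
  by rewrite !addr_ge0.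
exists (`|c| + (M * N%:R + `|dN|)).
have F1 lam : 1 <= 1 + sq_norm lam.
  by rewrite lerDl; apply: sumr_ge0 => i _; exact: sqr_ge0.
have F0 lam : 0 <= 1 + sq_norm lam by exact: le_trans (F1 lam).
split=> lam; first exact: F1.
  rewrite (le_trans (cP lam))// ler_wpM2r// (le_trans (ler_norm _))// lerDl.
  by rewrite addr_ge0// mulr_ge0.
rewrite DN_diag.
have : \sum_k - rates (shifted lam k) (shifted lam k) <=
    M * (N%:R * (1 + sq_norm lam)).
  apply: (@le_trans _ _ (\sum_(k < N) M * (1 + (shifted lam k)%:~R ^+ 2))).
    apply: ler_sum => k _; rewrite calD_diag opprD !opprK.
    exact: rate_total_le.
  rewrite -mulr_sumr ler_wpM2l// big_split /= sumr_const card_ord mulrDr mulr1.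
  rewrite lerD2l -/(sq_norm lam) ler_peMl ?ler1n//.
  by have := F1 lam; lra.
rewrite sumrN => H.
have : - dN <= `|dN| by rewrite -normrN ler_norm.
have : `|dN| <= `|dN| * (1 + sq_norm lam) by rewrite ler_peMr.
have : 0 <= `|c| * (1 + sq_norm lam) by rewrite mulr_ge0.
have : dN <= `|dN| by exact: ler_norm.
lra.
Qed.

End SignatureRates.

(** * Calculus and bounds for determinants *)

Section DeterminantCalculus.
Context {R : realType}.

Lemma continuous_bigprod (I : Type) (r : seq I) (F : I -> R -> R) :
  (forall i, continuous (F i)) -> continuous (fun x => \prod_(i <- r) F i x).
Proof.
move=> cF; elim: r => [|i r IHr] t.
  rewrite (_ : (fun _ => _) = (fun=> 1)); first exact: cst_continuous.
  by apply/funext => x; rewrite big_nil.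
rewrite (_ : (fun _ => _) = (fun x => F i x * \prod_(j <- r) F j x)).
  by apply: cvgM; [exact: cF|exact: IHr].
by apply/funext => x; rewrite big_cons.
Qed.

Lemma is_derive_bigprod m (F : 'I_m -> R -> R) (F' : 'I_m -> R) (t : R) :
  (forall i, is_derive t 1 (F i) (F' i)) ->
  is_derive t 1 (fun s => \prod_i F i s)
    (\sum_k \prod_i (if i == k then F' i else F i t)).
Proof.
elim: m F F' => [|m IHm] F F' dF.
  rewrite big_ord0 (_ : (fun _ => _) = (fun=> 1)); first exact: is_derive_const.
  by apply/funext => s; rewrite big_ord0.
rewrite (_ : (fun _ => _) = (fun s =>
    (\prod_(i < m) F (widen_ord (leqnSn m) i) s) * F ord_max s)); last first.
  by apply/funext => s; rewrite big_ord_recr.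
have := is_derive_mul (IHm _ _ (fun i => dF (widen_ord (leqnSn m) i)))
  (dF ord_max).
move=> /is_derive_eq; apply; rewrite big_ord_recr mulr_suml /=; congr (_ + _).
  apply: eq_bigr => k _; rewrite big_ord_recr /=; congr (_ * _).
  by rewrite -val_eqE /= gtn_eqF.
rewrite big_ord_recr /= eqxx; congr (_ * _); apply: eq_bigr => i _.
by rewrite -val_eqE /= ltn_eqF.
Qed.

Lemma continuous_det m (M : R -> 'M[R]_m) :
  (forall i j, continuous (fun t => M t i j)) -> continuous (fun t => \det (M t)).
Proof.
move=> cM; apply: continuous_bigsum => s; apply: continuous_cmul.
exact: continuous_bigprod.
Qed.

Lemma is_derive_det m (M : R -> 'M[R]_m) (M' : 'M[R]_m) (t : R) :
  (forall i j, is_derive t 1 (fun s => M s i j) (M' i j)) ->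
  is_derive t 1 (fun s => \det (M s)) (\sum_k \det (row_repl (M t) M' k)).
Proof.
move=> dM.
have := is_derive_bigsum (index_enum {perm 'I_m}) (fun s =>
  is_derive_cmul ((-1) ^+ s) (is_derive_bigprod (fun i => dM i (s i)))).
move=> /is_derive_eq; apply; rewrite exchange_big /=; apply: eq_bigr => s _.
rewrite mulr_sumr; apply: eq_bigr => k _; congr (_ * _); apply: eq_bigr => i _.
by rewrite mxE.
Qed.

(** Used for a row that tends to 0 while the other entries stay bounded. *)
Lemma det_le_row m (A : 'M[R]_m) i0 eta : (forall i j, `|A i j| <= 1) ->
  (forall j, `|A i0 j| <= eta) -> `|\det A| <= #|{perm 'I_m}|%:R * eta.
Proof.
move=> A1 Aeta; rewrite (le_trans (ler_norm_sum _ _ _))//.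
rewrite mulr_natl -sumr_const; apply: ler_sum => s _.
rewrite normrM normrX normrN1 expr1n mul1r normr_prod (bigD1 i0)//=.
rewrite -[leRHS]mulr1 ler_pM// ?prodr_ge0//.
by apply: prodr_ile1 => i _; rewrite normr_ge0 A1.
Qed.

Lemma det_le m (A : 'M[R]_m) : (forall i j, `|A i j| <= 1) ->
  `|\det A| <= #|{perm 'I_m}|%:R.
Proof.
move=> A1; rewrite (le_trans (ler_norm_sum _ _ _))// -sumr_const.
apply: ler_sum => s _; rewrite normrM normrX normrN1 expr1n mul1r normr_prod.
by apply: prodr_ile1 => i _; rewrite normr_ge0 A1.
Qed.

End DeterminantCalculus.

(** * Finite sets of signatures and the initial condition *)

Section FiniteSets.

Lemma finite_int_square (R : realType) (K : R) :
  finite_set [set x : int | 1 + x%:~R ^+ 2 <= K].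
Proof.
pose m := Num.bound `|K|.
apply: (@sub_finite_set _ _
  ((fun k : nat => k%:Z - m%:Z) @` `I_(m + m))); last first.
  exact/finite_image/finite_II.
move=> x /= xK.
have : `|x|%:~R < m%:R :> R.
  apply: le_lt_trans (archi_boundP (normr_ge0 K)).
  by rewrite intr_norm (le_trans (normr_le_sqr _))// (le_trans xK)// ler_norm.
rewrite pmulrn ltr_int => xm; exists (absz (x + m%:Z)); lia.
Qed.

Definition zero_signature N : signature N.
Proof.
exists [tuple of nseq N (0 : int)].
apply/(sortedP 0) => i _ /=; rewrite !nth_nseq.
by case: ifP => _; case: ifP.
Defined.

(** The map from signatures to their coordinates is injective. *)
Lemma finite_signatures N (S : set int) : finite_set S ->
  finite_set [set lam : signature N | forall i, S (shifted lam i)].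
Proof.
move=> /finite_seqP[s ->].
(* The coordinates of lam are read off as positions in s. *)
pose g (f : {ffun 'I_N -> 'I_(size s).+1}) : signature N :=
  insubd (zero_signature N)
    [tuple nth 0 s (f i) - N.-1%:Z + (i : nat)%:Z | i < N].
apply: (@sub_finite_set _ _ (g @` setT)); last first.
  by apply: finite_image; exact: finite_finset.
move=> lam /= lamS; exists [ffun i => inord (index (shifted lam i) s)] => //.
apply/val_inj; rewrite /g.
have E : [tuple nth 0 s ([ffun i => inord (index (shifted lam i) s)] i :
    'I_(size s).+1) - N.-1%:Z + (i : nat)%:Z | i < N] = val lam.
  apply: eq_from_tnth => i; rewrite tnth_mktuple ffunE inordK.
    rewrite nth_index ?lamS// /shifted; ring.
  by rewrite ltnS index_size.
by rewrite E valKd.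
Qed.

(** A strictly increasing map of {0, ..., N-1} to itself lies above the identity;
after reversing the order it also lies below. *)
Lemma increasing_ord_id N (f : 'I_N -> 'I_N) :
  (forall i j : 'I_N, (i < j)%N -> (f i < f j)%N) -> f =1 id.
Proof.
have ge (h : 'I_N -> 'I_N) : (forall i j : 'I_N, (i < j)%N -> (h i < h j)%N) ->
    forall i : 'I_N, (i <= h i)%N.
  move=> hi [i iN]; elim: i iN => // i IHi iN /=.
  have /= := hi (Ordinal (ltnW iN)) (Ordinal iN) (ltnSn i).
  by apply: leq_ltn_trans; exact: IHi.
move=> fi i; apply/ord_inj/eqP; rewrite eqn_leq ge// andbT.
have := ge (fun i => rev_ord (f (rev_ord i))) _ (rev_ord i).
rewrite rev_ordK /= => H.
have {H} : (N - i.+1 <= N - (f i).+1)%N.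
  apply: H => j k jk; have := fi (rev_ord k) (rev_ord j).
  by rewrite /=; have := ltn_ord j; have := ltn_ord k;
   have := ltn_ord (f (rev_ord j)); have := ltn_ord (f (rev_ord k)); lia.
by have := ltn_ord i; have := ltn_ord (f i); lia.
Qed.

(** Two different signatures have different sets of coordinates, since a strictly
decreasing sequence is determined by its set of values; so one row vanishes. *)
Lemma det_shifted_indicator (R : realType) N (lam nu : signature N) :
  \det (\matrix_(i, j) (shifted lam i == shifted nu j)%:R) = (lam == nu)%:R :> R.
Proof.
have [<-|ln] := eqVneq lam nu.
  rewrite -[RHS](det1 R N); congr (\det _); apply/matrixP => i j.
  by rewrite !mxE (inj_eq (@shifted_injective _ lam)).
have [|] := pselect (exists i, forall j, shifted lam i != shifted nu j).
  move=> [i li]; rewrite (expand_det_row _ i) big1// => j _.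
  by rewrite mxE (negbTE (li j)) mul0r.
move=> H; have {H} same i : exists j, shifted lam i = shifted nu j.
  apply: contrapT => nj; apply: H; exists i => j; apply/eqP => lj.
  by apply: nj; exists j.
have [f fE] := choice same.
case/eqP: ln; apply: shifted_ext => i; rewrite fE increasing_ord_id//.
move=> j k /(shifted_lt lam); rewrite !fE => lt.
rewrite ltnNge leq_eqVlt; apply/negP => /predU1P[/ord_inj fjk|/(shifted_lt nu)].
  by rewrite fjk ltxx in lt.
by rewrite ltNge (ltW lt).
Qed.

End FiniteSets.

(** * The determinantal formula *)

Section DeterminantalFormula.
Context {R : realType} (u u' v v' : complex R) {n : nat}.
Notation N := n.+2.
Hypothesis hu : forall k : int, 0 < (u + k%:~R) * (u' + k%:~R).
Hypothesis hv : forall k : int, 0 < (v + k%:~R) * (v' + k%:~R).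
Implicit Types (lam mu nu : signature N).
Notation rates := (calD u u' v v').
Notation dN := (dconst u u' v v' N).
Notation DN := (@calDN R u u' v v' N).
Notation fprod := (@fact_prod R N).
Notation p1 := (solution rates nbz).
Notation pN := (solution DN nbsig).
Let rf := calD_row_finite hu hv.
Let rfN := @DN_row_finite R u u' v v' n hu hv.

Lemma p1_decay (y : int) (t eta : R) : 0 <= t -> 0 < eta ->
  finite_set [set x | eta <= p1 y t x].
Proof.
move=> t0 e0; pose G (x : int) : R := (1 + x%:~R ^+ 2)^-1.
have D0 (x : int) : 0 < 1 + x%:~R ^+ 2 :> R by rewrite ltr_pwDl ?sqr_ge0.
have G0 x : 0 < G x by rewrite invr_gt0.
pose k := 24 * rate_bound u u' v v' + 6.
apply: sub_finite_set (finite_int_square (expR (t * k) / G y / eta)) => x /= ex.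
have := solution_decay rf (calD_lyapunov u u' v v') (fun a => ltW (G0 a)) (G0 y)
  (@gen_inv_square R u u' v v') x t0.
move=> /(le_trans ex); rewrite -/k mulrAC ler_pdivlMr// => H.
by rewrite ler_pdivlMr// mulrC.
Qed.

Lemma calD_column_bounded (y : int) :
  exists K : R, forall x, `|rates x y| <= K.
Proof.
exists (rate_up u u' (y - 1) + rate_down v v' (y + 1) +
  (rate_up u u' y + rate_down v v' y)) => x.
have U z := ltW (rate_up_gt0 hu z); have W z := ltW (rate_down_gt0 hv z).
have K0 := addr_ge0 (addr_ge0 (U (y - 1)) (W (y + 1))) (addr_ge0 (U y) (W y)).
have [->|yx] := eqVneq y x.
  rewrite calD_diag -opprD normrN ger0_norm ?addr_ge0//.
  by rewrite lerDr addr_ge0.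
have [|yn] := boolP (y \in nbz x); last by rewrite calD_off// normr0.
rewrite !inE => /orP[] /eqP yE.
  rewrite yE calD_up addrK ger0_norm//; have := W (x + 1 + 1).
  have := U (x + 1); have := W (x + 1); lra.
rewrite yE calD_down subrK ger0_norm//; have := U (x - 1 - 1).
have := U (x - 1); have := W (x - 1); lra.
Qed.

Lemma Dim_ratio_le nu lam : `|Dim R nu / Dim R lam| <= Dim R nu * fprod.
Proof.
rewrite ger0_norm; last by rewrite divr_ge0// ltW// Dim_gt0.
rewrite ler_wpM2l ?(ltW (Dim_gt0 _))// -[leRHS]invrK lef_pV2 ?Dim_ge//.
  by rewrite posrE Dim_gt0.
by rewrite posrE invr_gt0 fact_prod_gt0.
Qed.

Lemma DN_column_bounded nu : exists K : R, forall lam, `|DN lam nu| <= K.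
Proof.
have [K KP] := choice calD_column_bounded.
have K0 y : 0 <= K y by exact: le_trans (normr_ge0 _) (KP y 0).
exists (Dim R nu * fprod * (\sum_k K (shifted nu k)) + `|dN|) => lam.
rewrite (le_trans (ler_normB _ _))// lerD//; last first.
  by rewrite normrM ler_piMr// ger0_norm//; case: (_ == _).
rewrite normrM; apply: ler_pM => //; first exact: Dim_ratio_le.
rewrite (le_trans (ler_norm_sum _ _ _))//; apply: ler_sum => k _.
rewrite normrM -[leRHS]mulr1 ler_pM//.
by rewrite ger0_norm//; case: [forall i, _].
Qed.

Definition det_solution nu (t : R) lam : R :=
  expR (t * - dN) * (Dim R nu / Dim R lam) *
  \det (fun_mx (fun j => p1 (shifted nu j) t) (shifted lam)).

(** Differentiating the determinant replaces one row at a time by its time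
derivative, which by the equation on the integers is D applied to that row's
variable; [Dim_gen] recognizes the result. *)
Lemma det_solution_backward nu : backward DN nbsig (det_solution nu).
Proof.
move=> lam; split.
  move=> t; apply: cvgM; last first.
    apply: continuous_det => i j; rewrite (_ : (fun _ => _) =
        p1 (shifted nu j) ^~ (shifted lam i)); last first.
      by apply/funext => s; rewrite mxE.
    exact: continuous_solution.
  by apply: cvgM; [exact: continuous_expRM|exact: cvg_cst].
move=> t t0.
pose phi (j : 'I_N) := p1 (shifted nu j) t.
pose M' : 'M[R]_N := \matrix_(i, j) gen rates nbz (phi j) (shifted lam i).
have dM i j : is_derive t 1
    (fun s => fun_mx (fun j => p1 (shifted nu j) s) (shifted lam) i j) (M' i j).
  rewrite (_ : (fun _ => _) = p1 (shifted nu j) ^~ (shifted lam i)); last first.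
    by apply/funext => s; rewrite mxE.
  by rewrite mxE; exact: (solution_backward rf _ _).2.
have := is_derive_mul (is_derive_mul (is_derive_expRM (- dN) t)
  (is_derive_const (Dim R nu / Dim R lam) t)) (is_derive_det dM).
move=> /is_derive_eq; apply; apply: (mulfI (lt0r_neq0 (Dim_gt0 (R := R) lam))).
pose c := expR (t * - dN) * Dim R nu.
rewrite (@Dim_gen R u u' v v' N (fun x => c * \det (fun_mx phi x))); first last.
- move=> mu; rewrite /det_solution /c -/phi.
  by field; rewrite gt_eqF ?Dim_gt0.
- by move=> x i j ij xij; rewrite (det_fun_mx_alternating _ ij xij) mulr0.
have E : coord_gen u u' v v' (fun x => c * \det (fun_mx phi x)) (shifted lam) =
    c * \sum_k \det (row_repl (fun_mx phi (shifted lam)) M' k).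
  rewrite coord_gen_cmul (coord_gen_det hu hv); congr (_ * _).
  apply: eq_bigr => k _; rewrite det_row_repl; apply: eq_bigr => j _.
  by rewrite mxE.
by rewrite E /c -/phi; field; rewrite gt_eqF ?Dim_gt0.
Qed.

Let p1_bounded y (t : R) x : 0 <= t -> `|p1 y t x| <= 1.
Proof. by move=> t0; rewrite ger0_norm ?(solution_ge0 rf)// (solution_le1 rf). Qed.

(** Both sides solve the backward equation, are bounded and agree at time 0. *)
Lemma pN_det nu (t : R) lam : 0 <= t -> pN nu t lam = det_solution nu t lam.
Proof.
move=> t0; have [c LF] := @DN_lyapunov R u u' v v' n hu hv.
pose M := expR (t * `|dN|) * (Dim R nu * fprod) * #|{perm 'I_N}|%:R + 1.
apply: (backward_unique rfN LF (T := t) (M := M)); last by rewrite t0 lexx.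
- exact: solution_backward.
- exact: det_solution_backward.
- move=> s mu /andP[s0 _]; rewrite ger0_norm ?(solution_ge0 rfN)//.
  rewrite (le_trans (solution_le1 rfN _ _ s0))// lerDr mulr_ge0//.
  rewrite mulr_ge0 ?expR_ge0//.
  by rewrite mulr_ge0// ltW ?Dim_gt0 ?fact_prod_gt0.
- move=> s mu /andP[s0 st]; rewrite /det_solution /M.
  apply: (@le_trans _ _ (expR (t * `|dN|) * (Dim R nu * fprod) *
    #|{perm 'I_N}|%:R)); last by rewrite lerDl.
  rewrite normrM ler_pM//; last first.
    by apply: det_le => i j; rewrite mxE p1_bounded.
  rewrite normrM ler_pM// ?Dim_ratio_le// ger0_norm ?expR_ge0// ler_expR.
  apply: (@le_trans _ _ (s * `|dN|)); last by rewrite ler_wpM2r.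
  by rewrite ler_wpM2l// -normrN ler_norm.
- move=> mu; rewrite (solution0 rfN) /det_solution mul0r expR0 mul1r.
  have -> : fun_mx (fun j => p1 (shifted nu j) 0) (shifted mu) =
      \matrix_(i, j) (shifted mu i == shifted nu j)%:R.
    by apply/matrixP => i j; rewrite !mxE (solution0 rf).
  rewrite det_shifted_indicator; have [->|_] := eqVneq mu nu; last by rewrite mulr0.
  by rewrite divff ?mulr1// gt_eqF ?Dim_gt0.
Qed.

(** If all coordinates of lam had to stay in a finite set for the entry to be at
least eps, only finitely many lam would remain; and when one coordinate leaves
the set where some entry p1 is at least eta, a whole row of the determinant is
small. *)
Lemma pN_decay nu (t eps : R) : 0 <= t -> 0 < eps ->
  finite_set [set lam | eps <= `|pN nu t lam|].
Proof.
move=> t0 e0.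
pose C := expR (t * - dN) * (Dim R nu * fprod) * #|{perm 'I_N}|%:R + 1.
have C0 : 0 < C.
  rewrite ltr_wpDl// mulr_ge0// mulr_ge0 ?expR_ge0//.
  by rewrite mulr_ge0// ltW ?Dim_gt0 ?fact_prod_gt0.
(* Halving makes the final inequality strict. *)
pose eta := eps / C / 2.
have eta0 : 0 < eta by rewrite !divr_gt0.
pose S := \bigcup_(j in [set: 'I_N]) [set x | eta <= p1 (shifted nu j) t x].
have finS : finite_set S.
  by apply: bigcup_finite => [|j _]; [exact: finite_finset|exact: p1_decay].
apply: sub_finite_set (finite_signatures N finS) => lam /= big i.
apply: contrapT => Si.
have small j : p1 (shifted nu j) t (shifted lam i) <= eta.
  by rewrite leNgt; apply/negP => /ltW lt; apply: Si; exists j.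
move: big; rewrite pN_det// leNgt => /negP; apply.
have -> : eps = C * (eta * 2).
  by rewrite /eta; field; rewrite gt_eqF.
apply: (@le_lt_trans _ _ (C * eta)); last first.
  by rewrite ltr_pM2l// ltr_pMr// ltr1n.
have detle : `|\det (fun_mx (fun j => p1 (shifted nu j) t) (shifted lam))| <=
    #|{perm 'I_N}|%:R * eta.
  apply: (@det_le_row _ _ _ i) => [k j|j]; rewrite mxE ?p1_bounded//.
  by rewrite ger0_norm ?(solution_ge0 rf).
rewrite /det_solution normrM.
apply: (@le_trans _ _ (expR (t * - dN) * (Dim R nu * fprod) *
   (#|{perm 'I_N}|%:R * eta))).
  rewrite ler_pM// normrM ger0_norm ?expR_ge0// ler_wpM2l ?expR_ge0//.
  exact: Dim_ratio_le.
by rewrite mulrA ler_wpM2r ?(ltW eta0)// /C lerDl.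
Qed.

Lemma finite_sq_norm_le (K : R) :
  finite_set [set lam : signature N | 1 + sq_norm lam <= K].
Proof.
apply: sub_finite_set (finite_signatures N (finite_int_square K)) => lam /= lK i.
apply: le_trans lK; rewrite lerD2l /sq_norm (bigD1 i)//= lerDl.
by apply: sumr_ge0 => j _; exact: sqr_ge0.
Qed.

End DeterminantalFormula.

Theorem theorem5p4 (R : realType) (N : nat) (hN : (1 < N)%N)
  (u u' v v' : complex R)
  (hu : forall k : int, 0 < (u + k%:~R) * (u' + k%:~R))
  (hv : forall k : int, 0 < (v + k%:~R) * (v' + k%:~R))
  (huv : -1 < u + u' + v + v') :
  [/\ regular (@calDN R u u' v v' N),
      forall (t : R), 0 <= t -> forall lam nu : signature N,
        markov_semigroup (@calDN R u u' v v' N) t lam nu =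
        expR (- dconst u u' v v' N * t) * (Dim R nu / Dim R lam) *
        \det (\matrix_(i < N, j < N)
          markov_semigroup (calD u u' v v') t (shifted lam i) (shifted nu j))
    & feller (markov_semigroup (@calDN R u u' v v' N))].
Proof.
case: N hN => [|[|n]] // _.
have rf := calD_row_finite hu hv.
have rfN := @DN_row_finite R u u' v v' n hu hv.
have [c LF] := @DN_lyapunov R u u' v v' n hu hv.
split.
- by apply: regular_lyapunov rfN _ _ LF _; exact: finite_sq_norm_le.
- move=> t t0 lam nu; rewrite (markov_semigroupE rfN)// (pN_det hu hv)//.
  rewrite /det_solution [t * _]mulrC; congr (_ * \det _).
  by apply/matrixP => i j; rewrite !mxE (markov_semigroupE rf).
- apply: (feller_of_solution rfN) => [r t lam ur t0|nu|nu t eps t0 e0|].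
  + exact: (sum_solution_le1 rfN LF).
  + have [K KP] := DN_column_bounded hu hv nu; exists K => s t lam s0 t0.
    exact: (solution_lipschitz rfN LF KP).
  + exact: pN_decay.
  + exact: zero_signature.
Qed.
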